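(* Let $t \ge 1$ be an integer. If $M$ is a simple rank-$r$ matroid with no $(t+1)$-claw, then $|E(M)| \ge f(r,t)$. If equality holds, then either (i) $M \cong M_{r,t}$, or (ii) $t < r < 2t$ and $M$ is the direct sum of coloops and exactly $r-t$ circuits, not all of which are triangles.
   Context: A claw of a matroid $M$ is a set that is both a flat and an independent set of $M$; a $k$-claw is a claw of size $k$. A triangle is a $3$-element circuit. For integers $r \ge 0$, $t \ge 1$, $M_{r,t}$ denotes the direct sum of $t$ (possibly empty, i.e. rank-$0$) binary projective geometries whose ranks sum to $r$ and pairwise differ by at most $1$, and $f(r,t) = |E(M_{r,t})|$; explicitly $f(r,t) = (t-a)2^{\lfloor r/t\rfloor} + a2^{\lceil r/t \rceil} - t$ where $a \in \{0,\dots,t-1\}$ and $a \equiv r \pmod t$. *)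

(* Defs.v *)
From mathcomp Require Import all_boot all_algebra.
Set Implicit Arguments. Unset Strict Implicit. Unset Printing Implicit Defensive.
Import GRing.Theory.

Section Matroid.
Variable T : finType.
Variable indep : {set T} -> bool.

(* Matroid axioms (independence axioms); the ground set is all of T. *)
Definition is_matroid : Prop :=
  [/\ indep set0,
      (forall X Y : {set T}, indep Y -> X \subset Y -> indep X) &
      (forall X Y : {set T}, indep X -> indep Y -> #|X| < #|Y| ->
          exists2 e, e \in Y :\: X & indep (e |: X))].

Definition mrank (X : {set T}) : nat :=
  \max_(Y : {set T} | (Y \subset X) && indep Y) #|Y|.

Definition matroid_rank : nat := mrank setT.

Definition flat (X : {set T}) : bool :=
  [forall e, (e \notin X) ==> (mrank X < mrank (e |: X))].

Definition claw (X : {set T}) : bool := flat X && indep X.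

Definition has_k_claw (k : nat) : Prop := exists X : {set T}, claw X /\ #|X| = k.

Definition circuit (C : {set T}) : bool :=
  ~~ indep C && [forall Y : {set T}, (Y \proper C) ==> indep Y].

Definition triangle (C : {set T}) : bool := circuit C && (#|C| == 3).

Definition simple_matroid : Prop :=
  (forall e : T, indep [set e]) /\
  (forall e f : T, e != f -> indep [set e; f]).

End Matroid.

Definition matroid_iso (T T' : finType) (I : {set T} -> bool) (I' : {set T'} -> bool) : Prop :=
  exists f : T -> T', bijective f /\ forall X : {set T}, I' (f @: X) = I X.

Definition dsum_indep (J : finType) (T_ : J -> finType)
    (I_ : forall j, {set T_ j} -> bool) (X : {set {j : J & T_ j}}) : bool :=
  [forall j, I_ j [set x : T_ j | Tagged T_ x \in X]].

(* binary projective geometry of rank k: the nonzero vectors of GF(2)^k,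
   with linear independence (rank 0 gives the empty matroid) *)
Definition PG_type (k : nat) := {v : 'rV['F_2]_k | v != 0%R}.

Definition PG_indep (k : nat) (X : {set PG_type k}) : bool :=
  free [seq val x | x <- enum X].

Definition iso_Mrt (T : finType) (I : {set T} -> bool) (r t : nat) : Prop :=
  exists rk : 'I_t -> nat,
    [/\ \sum_(i < t) rk i = r,
        (forall i j : 'I_t, rk i <= (rk j).+1) &
        matroid_iso I (@dsum_indep 'I_t (fun i => PG_type (rk i)) (fun i => @PG_indep (rk i)))].

(* f(r,t) = (t-a) 2^floor(r/t) + a 2^ceil(r/t) - t, with a = r mod t *)
Definition f_rt (r t : nat) : nat :=
  let a := r %% t in
  (t - a) * 2 ^ (r %/ t) + a * 2 ^ (r %/ t + (a != 0)) - t.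

(* M is the direct sum of coloops and exactly m circuits, not all of which are
   triangles: pairwise disjoint circuits D_j of M, the remaining elements being
   coloops, and independence splitting along the components. *)
Definition coloops_circuits_dsum (T : finType) (I : {set T} -> bool) (m : nat) : Prop :=
  exists D : 'I_m -> {set T},
    let C := ~: \bigcup_(j < m) D j in
    [/\ (forall i j, i != j -> [disjoint D i & D j]),
        (forall j, circuit I (D j)),
        (forall e, e \in C -> I [set e]),
        (forall X : {set T},
            I X = [forall e in X :&: C, I [set e]] && [forall j, I (X :&: D j)]) &
        (exists j, ~~ triangle I (D j))].

(* Main.v *)
Require Import Defs.
From mathcomp Require Import all_boot all_algebra.
From mathcomp Require Import zify.
Set Implicit Arguments. Unset Strict Implicit. Unset Printing Implicit Defensive.

(** The function f(r,t) is the sum of 2^(i div t) over i < r, so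
f(r+t,t) = t + 2 f(r,t).  Let S be a maximal claw, of size s <= t.  Contracting S and
simplifying creates no (t+1)-claw, and maximality makes every parallel class of M/S have
at least two elements; hence |E(M)| >= s + 2 f(r-s,t) >= f(r,t), with equality only if
s = min(r,t).

Suppose |E(M)| = f(r,t) and r > t.  For a claw S of size t, every parallel class of M/S
is a pair {x, x'}, which together with a set foot(x) in S forms a circuit.  If e lies in
foot(x), then S - e + x is again a t-claw.  Comparing the two claws shows that if
foot(x) and foot(y) share e and x, y are not parallel in M/S, then the line of M/S
through x and y has a third point p with e in foot(p).

If r < 2t, then M/S is free, so the feet are disjoint and M is a direct sum of circuits
and coloops.  If r >= 2t, then every element of M/S lies in a t-claw of si(M/S), whose t
elements have disjoint feet inside the t-set S; hence all feet are singletons.  Colour x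
by the element of its foot, and e in S by itself: each colour class is a restriction in
which every line has at least three points, so it has at least 2^k - 1 elements if it has
rank k.  By convexity these bounds are tight, the ranks are balanced and add up to r, and
each class is a binary projective geometry. *)

(** * Rank functions, closures and fundamental circuits *)

Definition rankfn (T : finType) (rk : {set T} -> nat) : Prop :=
  [/\ (forall X : {set T}, rk X <= #|X|),
      (forall X Y : {set T}, X \subset Y -> rk X <= rk Y) &
      (forall X Y : {set T}, rk (X :|: Y) + rk (X :&: Y) <= rk X + rk Y)].

(* Locked so that inE does not unfold membership in a closure. *)
Definition cl (T : finType) (rk : {set T} -> nat) (X : {set T}) : {set T} :=
  locked [set x | rk (x |: X) == rk X].

Definition ind (T : finType) (rk : {set T} -> nat) (X : {set T}) : bool :=
  rk X == #|X|.

(* For ind B and y in cl B outside B, this is the fundamental circuit of y without y. *)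
Definition supp (T : finType) (rk : {set T} -> nat) (B : {set T}) (y : T) : {set T} :=
  [set b in B | y \notin cl rk (B :\ b)].

Section RankFunction.
Variables (T : finType) (rk : {set T} -> nat).
Hypothesis rkP : rankfn rk.
Implicit Types (X Y Z A B : {set T}) (x y : T).
Local Notation cl := (cl rk).
Local Notation ind := (ind rk).
Local Notation supp := (supp rk).

Lemma rk_leq_card X : rk X <= #|X|. Proof. by case: rkP. Qed.
Lemma rkS X Y : X \subset Y -> rk X <= rk Y. Proof. by case: rkP => _ + _; apply. Qed.
Lemma rk_submod X Y : rk (X :|: Y) + rk (X :&: Y) <= rk X + rk Y.
Proof. by case: rkP. Qed.

Lemma in_cl x X : (x \in cl X) = (rk (x |: X) == rk X).
Proof. by rewrite /cl -lock inE. Qed.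

Lemma rk0 : rk set0 = 0.
Proof. by apply/eqP; rewrite -leqn0 -(cards0 T) rk_leq_card. Qed.

Lemma rkU X Y : rk (X :|: Y) <= rk X + rk Y.
Proof. by apply: leq_trans (rk_submod X Y); apply: leq_addr. Qed.

Lemma sub_cl X : X \subset cl X.
Proof. by apply/subsetP=> x xX; rewrite in_cl (setUidPr _) ?sub1set. Qed.

Lemma clS X Y : X \subset Y -> cl X \subset cl Y.
Proof.
move=> sXY; apply/subsetP=> x; rewrite !in_cl => /eqP h.
rewrite eqn_leq (rkS (subsetUr _ _)) andbT.
have := rk_submod (x |: X) Y.
rewrite -setUA (setUidPr sXY) h.
have : rk X <= rk ((x |: X) :&: Y) by apply: rkS; rewrite subsetI subsetUr.
lia.
Qed.

Lemma rk_cl X : rk (cl X) = rk X.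
Proof.
apply/eqP; rewrite eqn_leq (rkS (sub_cl _)) andbT.
(* Elements of [cl X] are added to [X] one at a time, and none of them raises the rank. *)
suff H (s : seq T) : {subset s <= cl X} -> rk ([set x in s] :|: X) <= rk X.
  apply: leq_trans (H (enum (cl X)) _); last by move=> x; rewrite mem_enum.
  by apply: rkS; apply/subsetP=> x xX; rewrite !inE mem_enum xX.
elim: s => [|x s IH] H; first by rewrite set_nil set0U.
have /IH {}IH : {subset s <= cl X} by move=> y ys; apply: H; rewrite inE ys orbT.
have /(subsetP (clS (subsetUr [set x in s] X))) : x \in cl X by apply: H; rewrite inE eqxx.
by rewrite in_cl set_cons -setUA => /eqP->.
Qed.

Lemma cl_sub_cl X Y : X \subset cl Y -> cl X \subset cl Y.
Proof.
move=> /clS /subset_trans; apply; apply/subsetP=> x.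
rewrite !in_cl rk_cl => /eqP h; rewrite eqn_leq (rkS (subsetUr _ _)) andbT.
by rewrite -[leqRHS]h rkS // setUS // sub_cl.
Qed.

Lemma rk_sub_cl X Y : X \subset cl Y -> rk X <= rk Y.
Proof. by move/rkS; rewrite rk_cl. Qed.

Lemma rkU1 x X : x \notin cl X -> rk (x |: X) = (rk X).+1.
Proof.
rewrite in_cl => h; have := rkU [set x] X; have := rk_leq_card [set x].
have := rkS (subsetUr [set x] X); rewrite cards1; lia.
Qed.

Lemma cl_exch x y X : y \in cl (x |: X) -> y \notin cl X -> x \in cl (y |: X).
Proof.
move=> h1 h2; rewrite in_cl.
have xX : x \notin cl X.
  by apply: contraNN h2 => h; apply: (subsetP (cl_sub_cl _)) h1; rewrite subUset sub1set h sub_cl.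
move: h1; rewrite in_cl setUCA => /eqP->; by rewrite !rkU1.
Qed.

Lemma indS X Y : X \subset Y -> ind Y -> ind X.
Proof.
move=> sXY /eqP h; rewrite /ind eqn_leq rk_leq_card /=.
have := rkU X (Y :\: X); have := rk_leq_card (Y :\: X).
have -> : X :|: (Y :\: X) = Y by rewrite -{1}(setIidPr sXY) setID.
rewrite h.
have := cardsD Y X; rewrite (setIidPr sXY); have := subset_leq_card sXY; lia.
Qed.

Lemma indU1 x X : ind X -> x \notin cl X -> ind (x |: X).
Proof.
move=> /eqP h xX; rewrite /ind rkU1 // h cardsU1.
by rewrite (contraNN (subsetP (sub_cl X) x) xX).
Qed.

Lemma ind_notin_cl x X : ind (x |: X) -> x \notin X -> x \notin cl X.
Proof.
move=> h xX; rewrite in_cl (eqP h) cardsU1 xX.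
by rewrite (eqP (indS (subsetUr _ _) h)) neq_ltn orbC leqnn.
Qed.

Lemma ind_notin_cl_sub x X B : ind B -> x \in B -> X \subset B -> x \notin X -> x \notin cl X.
Proof.
move=> iB xB XB; apply: ind_notin_cl.
by apply: indS iB; rewrite subUset sub1set xB.
Qed.

(** Submodularity for [y |: A] and [y |: B]: their union has rank |A ∪ B|, so their intersection
    [y |: (A :&: B)] has rank at most |A| + |B| - |A ∪ B| = |A ∩ B|. *)
Lemma cl_inter A B y : ind (A :|: B) -> y \in cl A -> y \in cl B -> y \in cl (A :&: B).
Proof.
move=> iAB yA yB; rewrite in_cl eqn_leq (rkS (subsetUr _ _)) andbT.
have := rk_submod (y |: A) (y |: B); rewrite -setUIr.
have -> : (y |: A) :|: (y |: B) = y |: (A :|: B) by rewrite setUACA setUid.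
have /subsetP/(_ _ yA) := clS (subsetUl A B).
move: yA yB; rewrite !in_cl => /eqP-> /eqP-> /eqP->.
rewrite (eqP iAB) (eqP (indS (subsetUl _ _) iAB)) (eqP (indS (subsetUr _ _) iAB)).
have := cardsUI A B; have := rk_leq_card (A :&: B).
rewrite (eqP (indS (subset_trans (subsetIl A B) (subsetUl _ _)) iAB)); lia.
Qed.

Lemma extend_basis X Y : X \subset Y -> ind X ->
  exists B : {set T}, [/\ X \subset B, B \subset Y, ind B & Y \subset cl B].
Proof.
move=> sXY iX.
case: (@maxset_exists _ (fun Z : {set T} => (Z \subset Y) && ind Z) X) => [|B].
  by rewrite sXY.
case/maxsetP=> /andP[sBY iB] mB sXB; exists B; split=> //.
apply/subsetP=> y yY; apply/negPn/negP=> yB.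
have /negP[] := yB; apply: (subsetP (sub_cl B)).
rewrite -{1}(mB (y |: B)) ?setU11 ?subsetUr //.
by rewrite subUset sub1set yY sBY indU1.
Qed.

Lemma ind0 : ind set0. Proof. by rewrite /ind rk0 cards0. Qed.

Lemma exists_basis Y : exists B : {set T}, [/\ B \subset Y, ind B & Y \subset cl B].
Proof. by have [B [_ *]] := extend_basis (sub0set Y) ind0; exists B. Qed.

Lemma basis_card B Y : B \subset Y -> ind B -> Y \subset cl B -> #|B| = rk Y.
Proof.
move=> sBY /eqP <- sYB; apply/eqP.
by rewrite eqn_leq rkS //= rk_sub_cl.
Qed.

(** Take a minimal [A] inside [B] with y in its closure. If y were in cl(B - b) for some b in [A],
    then [cl_inter] would put y in cl(A - b), against minimality; so [A] lies in the support. *)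
Lemma cl_supp B y : ind B -> y \in cl B -> y \in cl (supp B y).
Proof.
move=> iB yB.
case: (@minset_exists _ (fun A : {set T} => (A \subset B) && (y \in cl A)) B) => [|A].
  by rewrite subxx.
case/minsetP=> /andP[sAB yA] mA _.
apply: (subsetP (clS _)) (yA); apply/subsetP=> b bA; rewrite inE (subsetP sAB) //=.
apply/negP=> yBb.
have : y \in cl (A :&: (B :\ b)).
  apply: cl_inter => //; apply: indS iB.
  by rewrite subUset sAB subD1set.
move=> h; have e : A :&: (B :\ b) = A.
  by apply: mA; rewrite ?subsetIl // h (subset_trans (subsetIl _ _) sAB).
by move: bA; rewrite -e !inE eqxx /= andbF.
Qed.

End RankFunction.

(** * The function f(r,t) *)

Definition minsize (r t : nat) : nat := \sum_(i < r) 2 ^ (i %/ t).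

Lemma minsizeS r t : minsize r.+1 t = minsize r t + 2 ^ (r %/ t).
Proof. by rewrite /minsize big_ord_recr. Qed.

Lemma minsize_small r t : r <= t -> minsize r t = r.
Proof.
move=> h; rewrite /minsize -[RHS]card_ord -sum1_card; apply: eq_bigr => i _.
by rewrite divn_small // (leq_trans _ h).
Qed.

Lemma minsizeDt r t : 0 < t -> minsize (r + t) t = t + 2 * minsize r t.
Proof.
move=> t0; rewrite /minsize addnC big_split_ord /=; congr (_ + _).
  by rewrite -[RHS](minsize_small (leqnn t)).
rewrite big_distrr; apply: eq_bigr => i _ /=.
by rewrite divnDl ?dvdnn // divnn t0 expnD.
Qed.

Lemma minsizeD_ge r m t : minsize r t + m <= minsize (r + m) t.
Proof.
elim: m => [|m IH]; first by rewrite !addn0.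
by rewrite !addnS minsizeS -addn1 leq_add // expn_gt0.
Qed.

(** For r > t this follows from f(r,t) = t + 2 f(r-t,t) and the growth of f by at least t - s from r
    - t to r - s. The slack [minn r t - s] later forces the size of a maximal claw in the extremal
    case. *)
Lemma minsize_step r t s : 0 < t -> s <= t -> s <= r ->
  minsize r t + (minn r t - s) <= s + 2 * minsize (r - s) t.
Proof.
move=> t0 st sr; case: (leqP r t) => [rt|/ltnW tr].
  by rewrite !minsize_small; lia.
have -> : r = r - t + t by lia.
rewrite minsizeDt //; have := minsizeD_ge (r - t) (t - s) t.
have -> : r - t + (t - s) = r - s by lia.
have -> : r - t + t - s = r - s by lia.
lia.
Qed.

Lemma minsize1 r : minsize r 1 = 2 ^ r - 1.
Proof.
elim: r => [|r IH]; first by rewrite /minsize big_ord0.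
by rewrite minsizeS IH divn1 expnS; have := expn_gt0 2 r; lia.
Qed.

Lemma minsize_divmod q a t : a <= t -> 0 < t ->
  minsize (q * t + a) t + t = t * 2 ^ q + a * 2 ^ q.
Proof.
move=> at' t0; elim: q => [|q IH].
  by rewrite mul0n add0n minsize_small // expn0 !muln1 addnC.
have -> : q.+1 * t + a = q * t + a + t by lia.
rewrite minsizeDt // expnS; lia.
Qed.

Lemma f_rtE r t : 0 < t -> f_rt r t = minsize r t.
Proof.
move=> t0; rewrite /f_rt.
have at' : r %% t < t by rewrite ltn_mod.
have := minsize_divmod (r %/ t) (ltnW at') t0; rewrite -divn_eq.
case: eqP => [->|/eqP a0] /=; first by rewrite addn0; lia.
rewrite addn1 expnS; have : 0 < 2 ^ (r %/ t) by rewrite expn_gt0.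
nia.
Qed.

(* Tangent line at q of the convex function a |-> 2 ^ a. *)
Lemma exp2_tangent q a : (a.+1 * 2 ^ q <= 2 ^ a + q * 2 ^ q)
  /\ (2 ^ a + q * 2 ^ q = a.+1 * 2 ^ q -> q <= a <= q.+1).
Proof.
case: (leqP q a) => [/subnKC<-|/[dup] aq /ltnW /subnKC e]; last first.
  have : 0 < 2 ^ a by rewrite expn_gt0.
  by rewrite -e; split; nia.
move: (a - q) => d; rewrite expnD.
have h : d.+1 <= 2 ^ d by apply: ltn_expl.
have q0 : 0 < 2 ^ q by rewrite expn_gt0.
split; first by nia.
move=> e; have {}e : 2 ^ d = d.+1 by nia.
case: d e {h} => [|[|d]] e; first by lia.
  by lia.
exfalso; have := ltn_expl d.+1 (isT : 1 < 2); rewrite expnS in e; lia.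
Qed.

(** Sum the tangent inequality at q = floor(R/t) over all j. The lower sum depends only on R and
    amounts to f(R,t); equality forces each a_j into {q, q+1}. *)
Lemma minsize_convex (J : finType) (a : J -> nat) : 0 < #|J| ->
  let R := \sum_j a j in
  minsize R #|J| <= \sum_j (2 ^ a j - 1) /\
  (\sum_j (2 ^ a j - 1) = minsize R #|J| -> forall i j, a i <= (a j).+1).
Proof.
move=> J0 R; set t := #|J|; set q := R %/ t.
(* Both sides are shifted by t + t q 2^q, so that no truncated subtraction is left. *)
have F1 : minsize R t + t + t * (q * 2 ^ q) = \sum_j ((a j).+1 * 2 ^ q).
  have at' : R %% t < t by rewrite ltn_mod.
  have := minsize_divmod (R %/ t) (ltnW at') J0; rewrite -divn_eq => ->.
  rewrite -/q -big_distrl /= (eq_bigr (fun j => a j + 1)); last by move=> *; rewrite addn1.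
  rewrite big_split /= sum1_card -/R -/t; have := divn_eq R t; rewrite -/q => eR; nia.
have F2 : \sum_j (2 ^ a j - 1) + t + t * (q * 2 ^ q) = \sum_j (2 ^ a j + q * 2 ^ q).
  rewrite big_split /= sum_nat_const; congr (_ + _).
  rewrite /t -sum1_card -big_split; apply: eq_bigr => j _ /=.
  by rewrite subnK // expn_gt0.
have L : \sum_j ((a j).+1 * 2 ^ q) <= \sum_j (2 ^ a j + q * 2 ^ q).
  by apply: leq_sum => j _; have [] := exp2_tangent q (a j).
split; first by lia.
move=> e i j.
have E : \sum_j (2 ^ a j + q * 2 ^ q) <= \sum_j ((a j).+1 * 2 ^ q) by lia.
have P k : q <= a k <= q.+1.
  have [l1] := exp2_tangent q (a k); apply; apply/eqP; rewrite eqn_leq l1 andbT.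
  move: E; rewrite (bigD1 k) //= [X in _ <= X](bigD1 k) //=.
  have : \sum_(j | j != k) ((a j).+1 * 2 ^ q) <= \sum_(j | j != k) (2 ^ a j + q * 2 ^ q).
    by apply: leq_sum => l _; have [] := exp2_tangent q (a l).
  lia.
have := P i; have := P j; lia.
Qed.

(** * Contraction of a claw *)

(** The ground set [E] is kept apart from the type [T]: restriction changes only [E] and contraction
    mainly [rk], so inductions never change the type. *)
Definition simple_on (T : finType) (rk : {set T} -> nat) (E : {set T}) : Prop :=
  (forall x, x \in E -> ind rk [set x]) /\
  (forall x y, x \in E -> y \in E -> y \in cl rk [set x] -> y = x).

Definition claw_on (T : finType) (rk : {set T} -> nat) (E X : {set T}) : bool :=
  [&& X \subset E, ind rk X & cl rk X :&: E \subset X].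

(* Elements of S stay in the ground type and become loops. *)
Definition contract (T : finType) (rk : {set T} -> nat) (S X : {set T}) : nat :=
  rk (X :|: S) - rk S.

Section Contraction.
Variables (T : finType) (rk : {set T} -> nat).
Hypothesis rkP : rankfn rk.
Implicit Types (E S X Y Z A B : {set T}) (x y : T).

Lemma contract_rankfn S : rankfn (contract rk S).
Proof.
split=> [X|X Y sXY|X Y]; rewrite /contract.
- have := rkU rkP X S; have := rk_leq_card rkP X; lia.
- by apply: leq_sub2r; apply: rkS => //; apply: setSU.
- have := rk_submod rkP (X :|: S) (Y :|: S); rewrite -setUIl -setUUl.
  have := rkS rkP (subsetUr (X :|: Y) S); have := rkS rkP (subsetUr (X :&: Y) S).
  have := rkS rkP (subsetUr X S); have := rkS rkP (subsetUr Y S); lia.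
Qed.

Lemma cl_contract S X : cl (contract rk S) X = cl rk (X :|: S).
Proof.
apply/setP=> x; rewrite !in_cl /contract -setUA.
have := rkS rkP (subsetUr (x |: X) S); have := rkS rkP (subsetUr X S).
rewrite -setUA; lia.
Qed.

Lemma ind_contract S X : ind rk S -> [disjoint X & S] ->
  ind (contract rk S) X = ind rk (X :|: S).
Proof.
move=> /eqP iS dX; rewrite /ind /contract cardsU.
rewrite (_ : X :&: S = set0) ?cards0; last by apply/eqP; rewrite setI_eq0.
have := rkS rkP (subsetUr X S); lia.
Qed.

Lemma simple_onS E X : X \subset E -> simple_on rk E -> simple_on rk X.
Proof.
move=> /subsetP s [h1 h2]; split=> [x /s|x y /s xE /s]; [exact: h1|exact: h2].
Qed.

(** A point of [E] in cl X lies in the flat [Y], and an independent [Y] has no point of cl X outside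
    [X]. *)
Lemma claw_sub E X Y : X \subset Y -> claw_on rk E Y -> claw_on rk E X.
Proof.
move=> sXY /and3P[sYE iY cY]; apply/and3P; split.
- exact: subset_trans sYE.
- exact: indS iY.
- apply/subsetP=> y /setIP[yX yE]; apply/negPn/negP => ynX.
  have yY : y \in Y by apply: (subsetP cY); rewrite inE yE (subsetP (clS rkP sXY)).
  by have := ind_notin_cl_sub rkP iY yY sXY ynX; rewrite yX.
Qed.

Lemma claw0 E : simple_on rk E -> claw_on rk E set0.
Proof.
case=> h _; apply/and3P; split; rewrite ?sub0set ?ind0 //.
apply/subsetP=> x /setIP[x0 xE].
have := h x xE; rewrite -(setU0 [set x]) => /(ind_notin_cl rkP).
by rewrite inE x0 => /(_ isT).
Qed.

Lemma claw1 E x : simple_on rk E -> x \in E -> claw_on rk E [set x].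
Proof.
case=> h h' xE; apply/and3P; split; rewrite ?sub1set ?h //.
by apply/subsetP=> y /setIP[yx yE]; rewrite inE (h' x y).
Qed.

Lemma cl_class S x y : x \notin cl rk S -> y \notin cl rk S -> y \in cl rk (x |: S) ->
  cl rk (y |: S) = cl rk (x |: S).
Proof.
move=> xS yS yx; apply/eqP; rewrite eqEsubset !cl_sub_cl // subUset sub1set.
  by rewrite (cl_exch rkP yx) //= (subset_trans _ (sub_cl rk _)) // subsetUr.
by rewrite yx (subset_trans _ (sub_cl rk _)) // subsetUr.
Qed.

Section Transversal.
Variables (E S : {set T}).
Hypothesis E_simple : simple_on rk E.
Hypothesis S_claw : claw_on rk E S.

Let SE : S \subset E. Proof. by case/and3P: S_claw. Qed.
Let iS : ind rk S. Proof. by case/and3P: S_claw. Qed.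

Lemma claw_notin_cl x : x \in E :\: S -> x \notin cl rk S.
Proof.
case/setDP=> xE; apply: contra => xS; case/and3P: S_claw => _ _ /subsetP; apply.
by rewrite inE xS.
Qed.

(** A representative of the parallel class of x in M/S. The pick depends on x only through cl(x +
    S), so parallel elements get the same one; the default is not reached for x in [E :\: S]. *)
Definition crep (x : T) : T := odflt x [pick y in cl rk (x |: S) :&: (E :\: S)].
Definition simplification : {set T} := crep @: (E :\: S).

Lemma crepP x : x \in E :\: S -> crep x \in cl rk (x |: S) /\ crep x \in E :\: S.
Proof.
move=> xES; rewrite /crep; case: pickP => [y /setIP[]//|/(_ x)].
by rewrite !in_setI xES (subsetP (sub_cl rk _)) // setU11.
Qed.

Lemma crep_eq x y : x \in E :\: S -> y \in E :\: S ->
  (crep y == crep x) = (y \in cl rk (x |: S)).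
Proof.
move=> xES yES; apply/eqP/idP => [e|yx].
  have [h1 h2] := crepP xES; have [h3 h4] := crepP yES.
  have := cl_class (claw_notin_cl xES) (claw_notin_cl h2) h1 => <-.
  by rewrite -e (cl_class (claw_notin_cl yES) (claw_notin_cl h4) h3) (subsetP (sub_cl rk _)) // setU11.
rewrite /crep (cl_class (claw_notin_cl xES) (claw_notin_cl yES) yx).
case: pickP => // /(_ x).
by rewrite !in_setI xES (subsetP (sub_cl rk _)) // setU11.
Qed.

Lemma simplification_sub : simplification \subset E :\: S.
Proof. by apply/subsetP=> _ /imsetP[x /crepP[_ ?] ->]. Qed.

Lemma crep_simplification x : x \in E :\: S -> crep x \in simplification.
Proof. by move=> h; apply: imset_f. Qed.

Lemma crep_id x : x \in simplification -> crep x = x.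
Proof.
case/imsetP=> y yES ->; have [h1 h2] := crepP yES.
by apply/eqP; rewrite crep_eq.
Qed.

Lemma simplification_class x y : x \in simplification -> y \in simplification ->
  y \in cl rk (x |: S) -> y = x.
Proof.
move=> xE yE; rewrite -crep_eq ?(subsetP simplification_sub) //.
by rewrite !crep_id // => /eqP.
Qed.

Lemma simplification_disj X : X \subset simplification -> [disjoint X & S].
Proof.
move=> /subset_trans/(_ simplification_sub); rewrite subsetD => /andP[] //.
Qed.

Lemma simplification_simple : simple_on (contract rk S) simplification.
Proof.
split=> [x xE'|x y xE' yE'].
  rewrite ind_contract ?simplification_disj ?sub1set //.
  by apply: indU1 => //; apply: claw_notin_cl; apply: (subsetP simplification_sub).
by rewrite cl_contract; apply: simplification_class.
Qed.

Lemma simplification_rank : contract rk S simplification = rk E - #|S|.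
Proof.
rewrite /contract -(eqP iS); congr (_ - _); apply/eqP; rewrite eqn_leq.
rewrite rkS //; last first.
  rewrite subUset SE andbT; exact: subset_trans simplification_sub (subsetDl _ _).
apply: rk_sub_cl => //; apply/subsetP=> x xE.
case xS: (x \in S); first by rewrite (subsetP (sub_cl rk _)) // inE xS orbT.
have xES : x \in E :\: S by rewrite inE xS.
have [h1 h2] := crepP xES.
have : x \in cl rk (crep x |: S).
  by rewrite -crep_eq // (crep_id (crep_simplification xES)).
apply/subsetP; apply: clS => //; apply: setSU; rewrite sub1set crep_simplification //.
Qed.

Lemma simplification_card :
  #|E :\: S| = \sum_(x in simplification) #|cl rk (x |: S) :&: (E :\: S)|.
Proof.
rewrite -sum1_card (partition_big crep (mem simplification)) /=; last first.
  exact: crep_simplification.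
apply: eq_bigr => x xE'; rewrite -sum1_card; apply: eq_bigl => y.
rewrite in_setI andbC; case yES: (y \in E :\: S); rewrite ?andbF //= !andbT.
by rewrite -{1}(crep_id xE') crep_eq // (subsetP simplification_sub).
Qed.

(* A claw of the simplification is already a claw: a point of its closure lies in
   the closure of S and a single element, and these meet in one point. *)
Lemma simplification_claw X :
  claw_on (contract rk S) simplification X -> claw_on rk E X.
Proof.
case/and3P=> sX; have dX := simplification_disj sX.
rewrite ind_contract // cl_contract => iXS cX; apply/and3P; split.
- apply: subset_trans sX _; exact: subset_trans simplification_sub (subsetDl _ _).
- by apply: indS iXS => //; apply: subsetUl.
apply/subsetP=> y /setIP[yX yE].
have yXS : y \in cl rk (X :|: S) by apply: (subsetP (clS rkP _)) yX; apply: subsetUl.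
case yS: (y \in S).
  have ynX : y \notin X by apply/negP=> yX'; move/disjoint_setI0/setP/(_ y): dX; rewrite !inE yX' yS.
  have yXS' : y \in X :|: S by rewrite inE yS orbT.
  by have := ind_notin_cl_sub rkP iXS yXS' (subsetUl _ _) ynX; rewrite yX.
have yES : y \in E :\: S by rewrite inE yS.
have [h1 h2] := crepP yES.
have rX : crep y \in X.
  apply: (subsetP cX); rewrite inE crep_simplification // andbT.
  apply: (subsetP (cl_sub_cl rkP _)) h1.
  by rewrite subUset sub1set yXS (subset_trans _ (sub_cl rk _)) // subsetUr.
have yr : y \in cl rk (crep y |: S).
  by rewrite -crep_eq // (crep_id (crep_simplification yES)).
have : y \in cl rk (X :&: (crep y |: S)).
  apply: cl_inter => //; apply: indS iXS => //.
  by rewrite setUCA subUset subxx andbT sub1set inE rX.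
suff -> : X :&: (crep y |: S) = [set crep y].
  by case: E_simple => _ /(_ (crep y) y) h /h ->; rewrite //; case/setDP: h2.
apply/setP=> z; rewrite !inE; case: eqP => [->|_]; first by rewrite rX.
apply/negbTE/negP=> /andP[zX /= zS]; move/disjoint_setI0/setP/(_ z): dX.
by rewrite !inE zX zS.
Qed.

End Transversal.

(** If x were alone in its parallel class of M/S, then S + x would be a larger claw. *)
Lemma maxclaw_class E S x : maxset (claw_on rk E) S -> x \in E :\: S ->
  exists2 y, y \in cl rk (x |: S) :&: (E :\: S) & y != x.
Proof.
move=> /maxsetP[cS mS] xES; have [xE xS] := setDP xES.
have /subsetPn[y /setIP[h1 h2] h3] : ~~ (cl rk (x |: S) :&: E \subset x |: S).
  apply/negP=> h; have /and3P[SE iS _] := cS.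
  have : claw_on rk E (x |: S).
    apply/and3P; split=> //; first by rewrite subUset sub1set xE.
    by apply: indU1 => //; apply: (claw_notin_cl cS).
  by move/mS => /(_ (subsetUr _ _)) e; move: xS; rewrite -e setU11.
move: h3; rewrite !inE negb_or => /andP[yx yS]; exists y => //.
by rewrite inE h1 inE yS.
Qed.

Lemma maxclaw_class_card E S x : maxset (claw_on rk E) S -> x \in E :\: S ->
  1 < #|cl rk (x |: S) :&: (E :\: S)|.
Proof.
move=> mS xES; have [y yc yx] := maxclaw_class mS xES.
rewrite (cardD1 x) (cardD1 y) inE (subsetP (sub_cl rk _)) ?setU11 // xES.
by rewrite !inE yx; move: yc; rewrite !inE => ->.
Qed.

Lemma maxclaw_card E S : maxset (claw_on rk E) S ->
  #|S| + 2 * #|simplification E S| <= #|E|.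
Proof.
move=> mS; have [cS _] := maxsetP mS; have /and3P[SE _ _] := cS.
have := cardsD E S; rewrite (setIidPr SE) (simplification_card cS).
have := subset_leq_card SE.
have : 2 * #|simplification E S| <=
    \sum_(x in simplification E S) #|cl rk (x |: S) :&: (E :\: S)|.
  rewrite mulnC -sum_nat_const; apply: leq_sum => x xE'.
  by apply: maxclaw_class_card => //; apply: (subsetP (simplification_sub _ _)).
lia.
Qed.

End Contraction.

(** * Extremal matroids *)

Lemma sum_leq_const (I : finType) (A : {set I}) (F : I -> nat) m :
  (forall i, i \in A -> m <= F i) -> \sum_(i in A) F i <= #|A| * m ->
  forall i, i \in A -> F i = m.
Proof.
move=> h s i iA; apply/eqP; rewrite eqn_leq h // andbT.
move: s; rewrite (bigD1 i) //= -sum_nat_const [X in _ <= X](bigD1 i) //=.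
have : \sum_(j in A | j != i) m <= \sum_(j in A | j != i) F j.
  by apply: leq_sum => j /andP[/h].
lia.
Qed.

Section Bound.
Variable T : finType.
Implicit Types (rk : {set T} -> nat) (E S X : {set T}).

Lemma maxclaw_exists rk E X : claw_on rk E X ->
  exists2 S : {set T}, maxset (claw_on rk E) S & X \subset S.
Proof. by move=> cX; have [S] := maxset_exists cX; exists S. Qed.

Lemma maxclaw_pos rk E S : rankfn rk -> simple_on rk E -> 0 < rk E ->
  maxset (claw_on rk E) S -> 0 < #|S|.
Proof.
move=> rkP sE r0 /maxsetP[cS mS]; rewrite card_gt0; apply/eqP => S0.
have /card_gt0P[x xE] : 0 < #|E| by apply: leq_trans r0 _; apply: rk_leq_card.
have := mS _ (claw1 sE xE); rewrite S0 sub0set => /(_ isT) /setP/(_ x).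
by rewrite !inE eqxx.
Qed.

(** Induction on the rank: when the rank is positive a maximal claw is nonempty, since singletons
    are claws, so the simplification of M/S has smaller rank. *)
Lemma size_bound t rk E : 0 < t -> rankfn rk -> simple_on rk E ->
  (forall X, claw_on rk E X -> #|X| <= t) -> minsize (rk E) t <= #|E|.
Proof.
move=> t0; have [n] := ubnP (rk E); elim: n rk E => // n IH rk E rn rkP sE cE.
have [->|r0] := posnP (rk E); first by rewrite minsize_small.
have [S mS _] := maxclaw_exists (claw0 rkP sE).
have [cS _] := maxsetP mS; have s0 := maxclaw_pos rkP sE r0 mS.
have /and3P[SE /eqP iS _] := cS.
have sr : #|S| <= rk E by rewrite -iS rkS.
have := IH (contract rk S) (simplification rk E S).
rewrite (simplification_rank rkP cS) => /(_ _ (contract_rankfn rkP S)).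
move=> /(_ _ (simplification_simple rkP cS)) H.
have := minsize_step t0 (cE _ cS) sr; have := maxclaw_card rkP mS.
have : minsize (rk E - #|S|) t <= #|simplification rk E S|.
  by apply: H => [|X /(simplification_claw rkP sE cS)/cE //]; lia.
lia.
Qed.

End Bound.

Section Extremal.
Variables (T : finType) (rk : {set T} -> nat) (E : {set T}) (t : nat).
Hypotheses (t0 : 0 < t) (rkP : rankfn rk) (E_simple : simple_on rk E).
Hypothesis claw_leq : forall X, claw_on rk E X -> #|X| <= t.
Hypothesis E_card : #|E| = minsize (rk E) t.
Implicit Types (S X : {set T}) (x y e p : T).

Lemma claw_rank S : claw_on rk E S -> #|S| <= rk E.
Proof. by case/and3P=> SE /eqP <- _; apply: rkS. Qed.

Lemma simplification_card_ge S : claw_on rk E S ->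
  minsize (rk E - #|S|) t <= #|simplification rk E S|.
Proof.
move=> cS; rewrite -(simplification_rank rkP cS).
apply: size_bound t0 (contract_rankfn rkP S) (simplification_simple rkP cS) _.
by move=> X /(simplification_claw rkP E_simple cS)/claw_leq.
Qed.

(** The lower bound on |E| obtained from [S] exceeds f(r,t) by at least [minn r t - #|S|], which
    must therefore vanish. *)
Lemma maxclaw_size S : maxset (claw_on rk E) S -> #|S| = minn (rk E) t.
Proof.
move=> mS; have [cS _] := maxsetP mS.
have := minsize_step t0 (claw_leq cS) (claw_rank cS).
have := simplification_card_ge cS; have := maxclaw_card rkP mS.
have := claw_rank cS; have := claw_leq cS; lia.
Qed.

Definition tclaw S := claw_on rk E S && (#|S| == t).

Lemma tclaw_claw S : tclaw S -> claw_on rk E S. Proof. by case/andP. Qed.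

Lemma tclaw_max S : tclaw S -> maxset (claw_on rk E) S.
Proof.
move=> /andP[cS /eqP St]; apply/maxsetP; split=> // X /claw_leq cX SX.
by apply/esym/eqP; rewrite eqEcard SX St cX.
Qed.

Lemma tclaw_extend X : t <= rk E -> claw_on rk E X -> exists2 S, tclaw S & X \subset S.
Proof.
move=> tr /maxclaw_exists[S mS XS]; exists S => //.
by rewrite /tclaw (maxclaw_size mS) (minn_idPr tr) eqxx andbT; case/maxsetP: mS.
Qed.

Lemma tclaw_simplification_card S : tclaw S ->
  #|simplification rk E S| = minsize (rk E - t) t.
Proof.
move=> tS; have /andP[cS /eqP St] := tS.
have := minsize_step t0 (claw_leq cS) (claw_rank cS).
have := simplification_card_ge cS; have := maxclaw_card rkP (tclaw_max tS).
rewrite St; lia.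
Qed.

(** There are 2 f(r-t,t) elements outside [S], in f(r-t,t) classes of at least two elements each. *)
Lemma tclaw_class_card S x : tclaw S -> x \in E :\: S ->
  #|cl rk (x |: S) :&: (E :\: S)| = 2.
Proof.
move=> tS xES; have /andP[cS /eqP St] := tS; have mS := tclaw_max tS.
have [h1 h2] := crepP rk xES.
rewrite -(cl_class rkP (claw_notin_cl cS xES) (claw_notin_cl cS h2) h1).
apply: (@sum_leq_const _ (simplification rk E S)
  (fun y => #|cl rk (y |: S) :&: (E :\: S)|)); last exact: crep_simplification.
  move=> y yE'; apply: maxclaw_class_card => //.
  exact: (subsetP (simplification_sub rk E S) _ yE').
rewrite -(simplification_card rkP cS) tclaw_simplification_card //.
have /and3P[SE _ _] := cS.
have := cardsD E S; rewrite (setIidPr SE) E_card St => ->.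
have := claw_rank cS; rewrite St => tr.
have := minsizeDt (rk E - t) t0; rewrite subnK //; lia.
Qed.

(** * Partners and feet relative to a t-claw *)

Definition partner S x : T := odflt x [pick y in (cl rk (x |: S) :&: (E :\: S)) :\ x].

(** For a t-claw [S] and x in [E :\: S], the fundamental circuit of the partner of x in the
    independent set x + S, without x and the partner. *)
Definition foot S x : {set T} := [set e in S | partner S x \notin cl rk (x |: S :\ e)].

Section Tclaw.
Variable S : {set T}.
Hypothesis tS : tclaw S.

Let cS : claw_on rk E S. Proof. exact: tclaw_claw. Qed.
Let SE : S \subset E. Proof. by case/and3P: cS. Qed.
Let iS : ind rk S. Proof. by case/and3P: cS. Qed.

Lemma partnerP x : x \in E :\: S -> [/\ partner S x != x, partner S x \in E :\: S,
  partner S x \in cl rk (x |: S) &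
  forall y, y \in E :\: S -> y \in cl rk (x |: S) -> (y == x) || (y == partner S x)].
Proof.
move=> xES; have [y yc yx] := maxclaw_class rkP (tclaw_max tS) xES.
have xc : x \in cl rk (x |: S) :&: (E :\: S).
  by rewrite in_setI xES (subsetP (sub_cl rk _)) // setU11.
rewrite /partner; case: pickP => [z|/(_ y)]; last by rewrite in_setD1 yx yc.
rewrite in_setD1 in_setI => /and3P[zx zc zES]; split=> // w wES wc /=.
apply/negPn/negP; rewrite negb_or => /andP[wx wz].
have := tclaw_class_card tS xES.
rewrite (cardD1 x) (cardD1 z) (cardD1 w) xc /=.
have -> : z \in [predD1 cl rk (x |: S) :&: (E :\: S) & x].
  by rewrite inE /= zx in_setI zc.
have -> // : w \in [predD1 [predD1 cl rk (x |: S) :&: (E :\: S) & x] & z].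
by rewrite inE /= wz inE /= wx in_setI wc.
Qed.

Lemma partner_in_cl x : x \in E :\: S -> partner S x \in cl rk (x |: foot S x).
Proof.
move=> xES; have [h1 h2 h3 _] := partnerP xES; have [xE xS] := setDP xES.
have ixS : ind rk (x |: S) by apply: indU1 => //; exact: (claw_notin_cl cS).
apply: (subsetP (clS rkP _)) (cl_supp rkP ixS h3); apply/subsetP=> b.
rewrite inE => /andP[/setU1P[->|bS]]; first by rewrite setU11.
rewrite !inE bS /= => h; rewrite (_ : x |: S :\ b = (x |: S) :\ b) ?h ?orbT //.
apply/setP=> z; rewrite !inE; case: (z =P x) => //= ->.
by rewrite (contraNneq _ xS) // => ->.
Qed.

Lemma foot_sub x : foot S x \subset S.
Proof. by apply/subsetP=> b; rewrite inE => /andP[]. Qed.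

(** An empty foot would make x and its partner parallel in M itself. *)
Lemma foot_gt0 x : x \in E :\: S -> 0 < #|foot S x|.
Proof.
move=> xES; rewrite card_gt0; apply/eqP => h.
have := partner_in_cl xES; rewrite h setU0.
have [h1 /setDP[h2 _] _ _] := partnerP xES; have [xE _] := setDP xES.
by case: E_simple => _ /(_ _ _ xE h2) H /H /eqP; apply/negP.
Qed.

(** Neither x nor its partner lies in cl(S - e), so exchange makes the defining condition symmetric
    in the two. *)
Lemma foot_partner x : x \in E :\: S -> foot S (partner S x) = foot S x.
Proof.
move=> xES; have [h1 h2 h3 _] := partnerP xES; set x' := partner S x in h1 h2 h3 *.
have ncl z e : z \in E :\: S -> z \notin cl rk (S :\ e).
  move/(claw_notin_cl cS); apply: contra; apply/subsetP/clS => //; exact: subD1set.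
have xx' : x \in cl rk (x' |: S) by apply: (cl_exch rkP h3) => //; exact: (claw_notin_cl cS).
have -> : foot S x' = [set e in S | x \notin cl rk (x' |: S :\ e)].
  rewrite /foot; have [_ _ _ /(_ _ xES xx')] := partnerP h2.
  by rewrite eq_sym (negbTE h1) /= => /eqP <-.
apply/setP=> e; rewrite !inE; congr (_ && ~~ _).
by apply/idP/idP => h; apply: (cl_exch rkP h) => //; apply: ncl.
Qed.

(** Besides x and [S], the flat cl(x + S) contains only the partner of x. In cl(x + S - e) the
    element e is missing by independence, and the partner because e is in the foot. *)
Lemma foot_swap x e : x \in E :\: S -> e \in foot S x -> tclaw (x |: S :\ e).
Proof.
move=> xES; rewrite inE => /andP[eS eF]; have [xE xS] := setDP xES.
have ixS : ind rk (x |: S) by apply: indU1 => //; exact: (claw_notin_cl cS).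
have sub : x |: S :\ e \subset x |: S by apply: setUS; apply: subD1set.
have exe : e \notin x |: S :\ e by rewrite !inE eqxx orbF (contraNneq _ xS) // => <-.
have ecl : e \notin cl rk (x |: S :\ e).
  by apply: ind_notin_cl_sub ixS _ sub exe => //; rewrite inE eS orbT.
apply/andP; split; last first.
  rewrite cardsU1 !inE (negbTE xS) andbF; have /andP[_ /eqP <-] := tS.
  by rewrite (cardsD1 e S) eS.
apply/and3P; split.
- by rewrite subUset sub1set xE (subset_trans (subD1set _ _)).
- exact: indS ixS.
apply/subsetP=> y /setIP[yc yE].
have yx : y \in cl rk (x |: S) by apply: (subsetP (clS rkP sub)).
case yS: (y \in S).
  have ye : y != e by apply: contraNneq ecl => ye; rewrite -{1}ye.
  by rewrite !inE yS ye orbT.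
have [_ _ _ /(_ y)] := partnerP xES; rewrite inE yS yE => /(_ isT yx).
case/orP=> /eqP e1; first by rewrite e1 setU11.
by rewrite e1 (negbTE eF) in yc.
Qed.

End Tclaw.

(** The point p is the partner of y relative to the second t-claw S1 = S - e + x, and S - e + y
    serves as a third t-claw. Thus p is a third point of the line through x and y in M/S. *)
Lemma foot_meet S x y e : tclaw S -> x \in E :\: S -> y \in E :\: S -> y \notin cl rk (x |: S) ->
  e \in foot S x -> e \in foot S y ->
  let p := partner (x |: S :\ e) y in
  [/\ p \in E :\: S, p \in cl rk (y |: (x |: S :\ e)), p \notin cl rk (x |: S),
      p \notin cl rk (y |: S) & e \in foot S p].
Proof.
move=> tS xES yES yx ex ey p; have cS := tclaw_claw tS; have /and3P[SE iS _] := cS.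
pose S1 := x |: S :\ e.
have [xE xS] := setDP xES; have [yE yS] := setDP yES.
have eS : e \in S by apply: (subsetP (foot_sub S x)).
have tS1 : tclaw S1 by apply: foot_swap.
have tS2 : tclaw (y |: S :\ e) by apply: foot_swap.
have iB : ind rk (y |: (x |: S)).
  by apply: indU1 => //; apply: indU1 => //; exact: (claw_notin_cl cS).
have yS1 : y \in E :\: S1.
  rewrite in_setD yE andbT !inE negb_or (negbTE yS) andbF andbT.
  by apply: contraNneq yx => ->; apply: (subsetP (sub_cl rk _)); rewrite setU11.
have [p1 p2 p3 p4] := partnerP tS1 yS1; rewrite -/p in p1 p2 p3 p4.
have sB : y |: S1 \subset y |: (x |: S) by rewrite setUS // setUS // subD1set.
have [pE pS1] := setDP p2.
have pe : p != e.
  apply: contraTneq p3 => ->; apply: ind_notin_cl_sub iB _ sB _ => //.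
    by rewrite !inE eS !orbT.
  by rewrite !inE eqxx orbF negb_or !(contraTneq _ eS) // => ->.
have pS : p \notin S.
  by move: pS1; rewrite !inE negb_or pe => /andP[].
have pES : p \in E :\: S by rewrite inE pS.
(* Everything happens inside the independent set y + x + S, so [cl_inter] applies. With Z = x + S it
   would put p in cl S1, with Z = y + S in cl(S - e + y); both are excluded, because p lies outside
   these claws. *)
have meet (Z : {set T}) : Z \subset y |: (x |: S) -> p \in cl rk Z -> p \in cl rk ((y |: S1) :&: Z).
  by move=> sZ pZ; apply: cl_inter => //; apply: indS iB => //; rewrite subUset sB.
have notin (S2 : {set T}) : tclaw S2 -> p \notin S2 -> p \notin cl rk S2.
  by move=> tS'' pS2; apply: (claw_notin_cl (tclaw_claw tS'')); rewrite inE pS2.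
have px : p \notin cl rk (x |: S).
  apply: contraNN (notin _ tS1 pS1) => /meet; rewrite subsetUr => /(_ isT).
  apply/subsetP; apply: clS => //; apply/subsetP=> z; rewrite !inE.
  case: (z =P y) => [->|_ /=]; last by case/andP.
  case/orP=> [/eqP->|]; last by rewrite (negbTE yS).
  by rewrite eqxx.
have py : p \notin cl rk (y |: S).
  have pS2 : p \notin y |: S :\ e by rewrite !inE negb_or p1 negb_and pS orbT.
  apply: contraNN (notin _ tS2 pS2) => /meet; rewrite setUCA subsetUr => /(_ isT).
  apply/subsetP; apply: clS => //; apply/subsetP=> z; rewrite !inE.
  case: (z =P y) => //= _ /andP[/orP[/eqP->|//]]; by rewrite (negbTE xS).
split=> //.
rewrite inE eS /=; have [q1 q2 q3 _] := partnerP tS pES; set q := partner S p in q1 q2 q3 *.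
have [qE qS] := setDP q2.
have pq : p \in cl rk (q |: S) by apply: (cl_exch rkP q3) => //; exact: (claw_notin_cl cS).
(* If e were not in the foot of p, the partner q of p relative to [S] would lie in cl(y + S1), hence
   in the class {y, p} relative to S1. Then q = y, and p would be in cl(y + S). *)
apply/negP => qc.
have qc1 : q \in cl rk (y |: S1).
  apply: (subsetP (cl_sub_cl rkP _)) qc; rewrite subUset sub1set p3.
  apply: subset_trans (sub_cl rk _); apply/subsetP=> z; rewrite !inE => ->.
  by rewrite !orbT.
have qS1 : q \in E :\: S1.
  rewrite in_setD qE andbT !inE negb_or (negbTE qS) andbF andbT.
  by apply: contraNneq px => <-.
have := p4 _ qS1 qc1; rewrite (negbTE q1) orbF => /eqP qy.
by rewrite qy (negbTE py) in pq.
Qed.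

End Extremal.

(** * Feet of elements of the simplified contraction *)

Section ExtremalFeet.
Variables (T : finType) (rk : {set T} -> nat) (E : {set T}) (t : nat).
Hypotheses (t0 : 0 < t) (rkP : rankfn rk) (E_simple : simple_on rk E).
Hypothesis claw_leq : forall X, claw_on rk E X -> #|X| <= t.
Hypothesis E_card : #|E| = minsize (rk E) t.
Variable S : {set T}.
Hypothesis tS : tclaw rk E t S.
Implicit Types (A : {set T}) (x y a b e : T).

Let cS : claw_on rk E S. Proof. exact: tclaw_claw tS. Qed.
Local Notation E' := (simplification rk E S).
Local Notation rk' := (contract rk S).
Local Notation foot := (foot rk E S).

(** A common e gives, by [foot_meet], a point p on the line through a and b in M/S. Its
    representative lies in the flat [A] and differs from a and b, against the independence of
    [A]. *)
Lemma foot_disjoint A a b e : claw_on rk' E' A -> a \in A -> b \in A -> a != b ->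
  e \in foot a -> e \notin foot b.
Proof.
case/and3P=> AE' iA cA aA bA ab ea; apply/negP => eb.
have sE' := subsetP (simplification_sub rk E S).
have aE' := subsetP AE' a aA; have bE' := subsetP AE' b bA.
have nba : b \notin cl rk (a |: S).
  by apply/negP => h; move: ab; rewrite (simplification_class rkP cS aE' bE' h) eqxx.
have [] := foot_meet t0 rkP E_simple claw_leq E_card tS (sE' _ aE') (sE' _ bE') nba ea eb.
set p := partner _ _ _ _ => pES pc pa pb _.
have [q1 q2] := crepP rk pES; set q := crep rk E S p in q1 q2.
have qE' : q \in E' by apply: crep_simplification.
have clq := cl_class rkP (claw_notin_cl cS pES) (claw_notin_cl cS q2) q1.
have pq : p \in cl rk (q |: S) by rewrite clq (subsetP (sub_cl rk _)) // setU11.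
have qab : q \in cl rk' [set a; b].
  rewrite cl_contract //; apply: (subsetP (cl_sub_cl rkP _)) q1.
  rewrite subUset sub1set (subset_trans (subsetUr [set a; b] S) (sub_cl rk _)) andbT.
  apply: (subsetP (clS rkP _)) pc; apply/subsetP=> z; rewrite !inE.
  by case/or3P=> [->|->|/andP[_ ->]]; rewrite ?orbT.
have sab : [set a; b] \subset A by rewrite subUset !sub1set aA.
have qA : q \in A.
  apply: (subsetP cA); rewrite inE qE' andbT.
  by apply: (subsetP (clS (contract_rankfn rkP S) sab)).
have qnab : q \notin [set a; b].
  by rewrite !inE negb_or (contraNneq _ pa) ?(contraNneq _ pb) // => <-.
by have := ind_notin_cl_sub (contract_rankfn rkP S) iA qA sab qnab; rewrite qab.
Qed.

Lemma foot_card1 x : t <= rk E - t -> x \in E :\: S -> #|foot x| = 1.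
Proof.
move=> tr xES; have /andP[_ /eqP St] := tS.
have rE' : rk' E' = rk E - t by rewrite (simplification_rank rkP cS) St.
have sE' := simplification_simple rkP cS.
have [q1 q2] := crepP rk xES; set q := crep rk E S x in q1 q2.
have qE' : q \in E' by apply: crep_simplification.
have cle X : claw_on rk' E' X -> #|X| <= t.
  by move/(simplification_claw rkP E_simple cS)/claw_leq.
(* The simplification is again extremal and has rank at least t, so the claw {q} extends to a t-claw
   [A] of it. *)
have [] := tclaw_extend t0 (contract_rankfn rkP S) sE' cle _ _ (claw1 sE' qE').
- by rewrite rE'; apply: tclaw_simplification_card tS.
- by rewrite rE'.
move=> A /andP[cA /eqP At]; rewrite sub1set => qA.
have -> : foot x = foot q.
  have [_ _ _ /(_ q q2 q1)/orP[/eqP->//|/eqP->]] := partnerP t0 rkP E_simple claw_leq E_card tS xES.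
  by rewrite (foot_partner t0 rkP E_simple claw_leq E_card).
have AES a : a \in A -> a \in E :\: S.
  by case/and3P: cA => /subsetP sA _ _ /sA; apply/subsetP/simplification_sub.
apply: (@sum_leq_const _ A (fun a => #|foot a|)) qA => [a aA|].
  exact: (foot_gt0 t0 rkP E_simple claw_leq E_card tS (AES _ aA)).
(* Count the pairs (a, e) with e in the foot of a: each of the t elements of [S] lies in at most one
   foot, and each of the t feet is nonempty. *)
have -> : \sum_(a in A) #|foot a| = \sum_(e in S) #|[set a in A | e \in foot a]|.
  transitivity (\sum_(a in A) \sum_(e in S) (e \in foot a)).
    apply: eq_bigr => a _; rewrite -sum1_card [RHS]big_mkcond [LHS]big_mkcond.
    apply: eq_bigr => e _; have := subsetP (foot_sub rk E S a) e.
    by case: (e \in foot a) => [->|_] //; case: (e \in S).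
  rewrite exchange_big; apply: eq_bigr => e _ /=.
  rewrite -sum1_card [RHS]big_mkcond [LHS]big_mkcond; apply: eq_bigr => a _.
  by rewrite in_set; case: (a \in A); case: (e \in foot a).
rewrite At muln1 -[leqRHS]St -sum1_card; apply: leq_sum => e eS.
apply/card_le1_eqP => a b /setIdP[aA ea] /setIdP[bA eb]; apply/eqP.
by apply: contraTT eb; rewrite eq_sym => ab; exact: (foot_disjoint cA aA bA ab ea).
Qed.

(** The simplification has rank r - t <= t and f(r-t,t) = r - t elements, so it is free. *)
Lemma simplification_is_claw : rk E <= 2 * t -> claw_on rk' E' E'.
Proof.
move=> rt; have /andP[_ /eqP St] := tS.
apply/and3P; split=> //; last by apply: subsetIr.
rewrite /ind (simplification_rank rkP cS) St.
rewrite (tclaw_simplification_card t0 rkP E_simple claw_leq E_card tS) minsize_small //; lia.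
Qed.

End ExtremalFeet.

(** * Projective geometries *)

Definition thirds (T : finType) (rk : {set T} -> nat) (E : {set T}) : Prop :=
  forall x y, x \in E -> y \in E -> x != y ->
    exists z, [/\ z \in E, z != x, z != y & z \in cl rk [set x; y]].

Section ProjectiveGeometry.
Import GRing.Theory.
Variables (T : finType) (rk : {set T} -> nat).
Hypothesis rkP : rankfn rk.
Implicit Types (x y z h : T) (E H X B : {set T}).

(** A claw with two points would also contain a third point of their line, which independence
    forbids. So there is no 2-claw, and the size bound applies with t = 1. *)
Lemma thirds_card_ge E : simple_on rk E -> thirds rk E -> 2 ^ rk E - 1 <= #|E|.
Proof.
move=> sE tE; rewrite -minsize1; apply: size_bound => // X /and3P[XE iX cX].
apply/card_le1_eqP => x y xX yX; apply/eqP; rewrite eq_sym; apply/negPn/negP=> xy.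
have [z [zE zx zy zc]] := tE x y (subsetP XE x xX) (subsetP XE y yX) xy.
have sX : [set x; y] \subset X by rewrite subUset !sub1set xX.
have zX : z \in X by apply: (subsetP cX); rewrite inE zE (subsetP (clS rkP sX)).
have := ind_notin_cl_sub rkP iX zX sX; rewrite zc !inE negb_or zx zy.
by move/(_ isT).
Qed.

Lemma line_exch E x y z : simple_on rk E -> x \in E -> z \in E ->
  z \in cl rk [set x; y] -> z != x -> y \in cl rk [set x; z].
Proof.
case=> _ sE xE zE zc zx; rewrite setUC; apply: (cl_exch rkP); first by rewrite setUC.
by apply: contraNN zx => /(sE _ _ xE zE) ->.
Qed.

Section Hyperplane.
Variables E H : {set T}.
Hypotheses (E_simple : simple_on rk E) (E_thirds : thirds rk E).
Hypotheses (HE : H \subset E) (H_flat : cl rk H :&: E \subset H).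

Lemma flat_third x y z : x \in H -> y \in H -> z \in E -> z \in cl rk [set x; y] -> z \in H.
Proof.
move=> xH yH zE zc; apply: (subsetP H_flat); rewrite inE zE andbT.
by apply: (subsetP (clS rkP _)) zc; rewrite subUset !sub1set xH.
Qed.

(** Two points of [H] on a line through x would put the whole line, and so x, in the flat [H]. *)
Lemma flat_line x h h' : x \in E -> x \notin H -> h \in H -> h' \in H ->
  h' \in cl rk [set x; h] -> h' = h.
Proof.
move=> xE xH hH h'H h'c; apply/eqP; apply: contraNT xH => hh.
apply: (flat_third hH h'H) => //; rewrite setUC in h'c.
by apply: line_exch E_simple _ _ h'c hh; apply: (subsetP HE).
Qed.

Hypotheses (E_card : #|E| = 2 ^ rk E - 1) (H_rank : rk E = (rk H).+1).

(* Joining a point outside the hyperplane H to the points of H produces |H| further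
   points outside H, which by the count of points are all there are: so every line
   meets H. *)
Lemma hyperplane_third x y z : x \in E -> x \notin H -> y \in E -> y \notin H -> x != y ->
  z \in E -> z != x -> z != y -> z \in cl rk [set x; y] -> z \in H.
Proof.
move=> xE xH yE yH xy zE zx zy zc; apply/negPn/negP=> zH.
have ex h : exists g, h \in H -> [/\ g \in E, g != x, g != h & g \in cl rk [set x; h]].
  case hH: (h \in H); last by exists x.
  have xh : x != h by apply: contraNneq xH => ->.
  by have [g] := E_thirds xE (subsetP HE h hH) xh; exists g.
have [g gP] := fin_all_exists ex.
have gH h : h \in H -> g h \notin H.
  move=> hH; have [g1 g2 g3 g4] := gP h hH; apply: contraNN xH => ghH.
  apply: (flat_third hH ghH) => //; rewrite setUC in g4.
  by apply: line_exch E_simple _ _ g4 g3; apply: (subsetP HE).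
have back h : h \in H -> h \in cl rk [set x; g h].
  by move=> hH; have [g1 g2 g3 g4] := gP h hH; apply: line_exch E_simple _ _ g4 g2.
have gi : {in H &, injective g}.
  move=> h h' hH h'H e; apply/esym; apply: (flat_line xE xH) => //.
  apply: (subsetP (cl_sub_cl rkP _)) (back h' h'H); rewrite -e subUset !sub1set.
  by have [_ _ _ ->] := gP h hH; rewrite (subsetP (sub_cl rk _)) // !inE eqxx.
have im : g @: H = (E :\: H) :\ x.
  apply/eqP; rewrite eqEcard; apply/andP; split.
    apply/subsetP=> _ /imsetP[h hH ->]; have [g1 g2 g3 g4] := gP h hH.
    by rewrite !inE g2 gH.
  rewrite card_in_imset //; have := cardsD E H; rewrite (setIidPr HE) E_card H_rank.
  have := cardsD1 x (E :\: H); rewrite inE xE xH /=.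
  (* Lines of [H] inherit their third points, so |H| >= 2^(r-1) - 1 where r is the rank of [E];
     hence at most |H| points of [E] other than x lie outside [H]. *)
  have sH : thirds rk H.
    move=> u v uH vH uv; have [w [wE wu wv wc]] := E_thirds (subsetP HE u uH) (subsetP HE v vH) uv.
    by exists w; split=> //; apply: flat_third wc.
  have := thirds_card_ge (simple_onS HE E_simple) sH; rewrite expnS; lia.
have : y \in g @: H by rewrite im !inE eq_sym xy yH.
case/imsetP=> h hH ey.
have : z \in g @: H by rewrite im !inE zx zH.
case/imsetP=> h' h'H ez.
suff e : h' = h by rewrite ez e ey eqxx in zy.
apply: (flat_line xE xH) => //.
apply: (subsetP (cl_sub_cl rkP _)) (back h' h'H); rewrite -ez subUset !sub1set.
rewrite (subsetP (sub_cl rk _)) ?(inE, eqxx) //=.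
apply: (subsetP (cl_sub_cl rkP _)) zc; rewrite ey subUset !sub1set.
by have [_ _ _ ->] := gP h hH; rewrite (subsetP (sub_cl rk _)) // !inE eqxx.
Qed.

End Hyperplane.

Section Coordinates.
Variables E B : {set T}.
Hypotheses (E_simple : simple_on rk E) (E_thirds : thirds rk E).
Hypotheses (BE : B \subset E) (B_ind : ind rk B) (EB : E \subset cl rk B).
Hypothesis E_card : #|E| = 2 ^ rk E - 1.

Local Open Scope ring_scope.

Let b (j : 'I_#|B|) : T := enum_val j.
Let H (j : 'I_#|B|) : {set T} := cl rk (B :\ b j) :&: E.

(** [H j] is the hyperplane of [E] spanned by [B] without its j-th element. Over GF(2) a coordinate
    is determined by its zero set, so the j-th one records only whether x avoids [H j]. *)
Definition coords (x : T) : 'rV['F_2]_#|B| := \row_j (x \notin H j)%:R.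

Lemma coords_neq0 x : x \in E -> coords x != 0.
Proof.
move=> xE; apply/negP=> /eqP c0.
have : x \in cl rk (supp rk B x) by apply: cl_supp => //; apply: (subsetP EB).
have -> : supp rk B x = set0.
  apply/setP=> c; rewrite inE [RHS]inE; apply/negbTE/negP => /andP[cB xc].
  have := congr1 (fun v : 'rV_#|B| => v 0 (enum_rank_in cB c)) c0.
  by rewrite !mxE /H /b enum_rankK_in // inE negb_and xc.
by case/and3P: (claw0 rkP E_simple) => _ _ /subsetP/(_ x) h xc; move: h; rewrite inE xc xE inE => /(_ isT).
Qed.

(** Of the collinear points x, y, z, each [H j] contains exactly one or all three, so the j-th
    coordinates sum to zero modulo 2. *)
Lemma coords_third x y z : x \in E -> y \in E -> x != y ->
  z \in E -> z != x -> z != y -> z \in cl rk [set x; y] -> coords z = coords x + coords y.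
Proof.
move=> xE yE xy zE zx zy zc; apply/rowP=> j; rewrite !mxE.
have HE : H j \subset E by apply: subsetIr.
have bB : b j \in B by apply: enum_valP.
have clH : cl rk (H j) = cl rk (B :\ b j).
  apply/eqP; rewrite eqEsubset cl_sub_cl ?subsetIl //= clS // subsetI sub_cl.
  by rewrite (subset_trans (subD1set _ _)).
have Hf : cl rk (H j) :&: E \subset H j by rewrite clH.
have Hr : rk E = (rk (H j)).+1.
  rewrite -(basis_card rkP BE B_ind EB) -(rk_cl rkP (H j)) clH rk_cl //.
  rewrite (eqP (indS rkP (subD1set B (b j)) B_ind)) (cardsD1 (b j)) bB //.
have xcz : x \in cl rk [set y; z].
  by apply: (line_exch E_simple) => //; rewrite setUC.
have ycz : y \in cl rk [set x; z] by apply: (line_exch E_simple).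
case xH: (x \in H j); case yH: (y \in H j).
- by rewrite (flat_third Hf xH yH zE zc) addr0.
- case zH: (z \in H j); last by rewrite add0r.
  by rewrite (flat_third Hf xH zH yE ycz) in yH.
- case zH: (z \in H j); last by rewrite addr0.
  by rewrite (flat_third Hf yH zH xE xcz) in xH.
- have -> : z \in H j.
    apply: (hyperplane_third E_simple E_thirds HE Hf E_card Hr _ _ _ _ xy) => //.
      by rewrite xH.
    by rewrite yH.
  by apply/eqP.
Qed.

(** If x and y had equal coordinates, a third point of their line would have coordinates zero. *)
Lemma coords_inj : {in E &, injective coords}.
Proof.
move=> x y xE yE e; apply/eqP/negPn/negP=> xy.
have [z [zE zx zy zc]] := E_thirds xE yE xy.
have := coords_neq0 zE; rewrite (coords_third xE yE xy zE zx zy zc) e.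
by apply/negP/negPn/eqP/rowP=> j; rewrite !mxE; case: (y \notin H j); apply/eqP.
Qed.

Lemma F2_cases (k : 'F_2) : k = 0 \/ k = 1.
Proof. by case: k => [[|[|//]]] i; [left|right]; apply/val_inj. Qed.

(** The coordinate vectors of [E] together with 0 are closed under addition, because third points
    exist; this turns linear span into matroid closure. *)
Lemma span_coords (s : seq T) v : {subset s <= E} -> v \in <<map coords s>>%VS ->
  v = 0 \/ exists z, [/\ z \in E, z \in cl rk [set x in s] & coords z = v].
Proof.
elim: s v => [|x s IH] v sE /=.
  by rewrite span_nil memv0 => /eqP; left.
have xE : x \in E by apply: sE; rewrite inE eqxx.
have xc : x \in cl rk [set y in x :: s] by rewrite (subsetP (sub_cl rk _)) // !inE eqxx.
rewrite span_cons => /memv_addP[u /vlineP[k ->] [w wc ->]].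
have /IH/(_ wc) {wc} : {subset s <= E} by move=> y ys; apply: sE; rewrite inE ys orbT.
have sub : cl rk [set y in s] \subset cl rk [set y in x :: s].
  by apply: clS => //; apply/subsetP=> y; rewrite !inE => ->; rewrite orbT.
case: (F2_cases k) => ->; rewrite (scale0r, scale1r) ?add0r.
  by case=> [|[z [zE zc zw]]]; [left|right; exists z; rewrite (subsetP sub)].
case=> [->|[z [zE zc <-]]]; first by right; exists x; rewrite addr0.
have [->|xz] := eqVneq x z.
  by left; apply/rowP=> j; rewrite !mxE; case: (z \notin H j); apply/eqP.
have [y [yE yx yz yc]] := E_thirds xE zE xz; right; exists y; split=> //.
  apply: (subsetP (cl_sub_cl rkP _)) yc; rewrite subUset !sub1set xc.
  exact: (subsetP sub).
exact: coords_third.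
Qed.

Lemma ind_free_coords X : X \subset E -> ind rk X -> free [seq coords x | x <- enum X].
Proof.
move=> XE; have -> : X = [set x in enum X] by apply/setP=> x; rewrite inE mem_enum.
rewrite set_enum; have : {subset enum X <= E} by move=> x; rewrite mem_enum; apply/subsetP.
have -> : ind rk X = ind rk [set x in enum X] by rewrite set_enum.
elim: (enum X) (enum_uniq X) => [|x s IH] /=; first by rewrite nil_free.
case/andP=> xs us sE; rewrite set_cons => ixs.
have xE : x \in E by apply: sE; rewrite inE eqxx.
have sE' : {subset s <= E} by move=> y ys; apply: sE; rewrite inE ys orbT.
rewrite free_cons IH ?andbT //; last by apply: indS ixs => //; apply: subsetUr.
apply/negP=> /(span_coords sE')[x0|[z [zE zc /coords_inj zx]]].
  by have := coords_neq0 xE; rewrite x0 eqxx.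
have := ind_notin_cl rkP ixs; rewrite inE xs => /(_ isT).
by rewrite -(zx zE xE) zc.
Qed.

(** Enlarge [X] to a maximal [Z] with free coordinates. By maximality [Z] spans [E], and by
    dimension it has at most |B| = rk E elements, so it is independent. *)
Lemma free_coords_ind X : X \subset E -> free [seq coords x | x <- enum X] -> ind rk X.
Proof.
move=> XE fX.
case: (@maxset_exists _ (fun Z : {set T} =>
  (Z \subset E) && free [seq coords x | x <- enum Z]) X) => [|Z].
  by rewrite XE.
case/maxsetP=> /andP[ZE fZ] mZ XZ; apply: (indS rkP XZ).
have sZ : {subset enum Z <= E} by move=> x; rewrite mem_enum; apply/subsetP.
have EZ : E \subset cl rk Z.
  apply/subsetP=> e eE; case eZ: (e \in Z); first exact: (subsetP (sub_cl rk _)).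
  have : coords e \in <<[seq coords x | x <- enum Z]>>%VS.
    apply/negPn/negP=> he.
    have p : perm_eq (e :: enum Z) (enum (e |: Z)).
      apply: uniq_perm; rewrite /= ?enum_uniq ?mem_enum ?eZ //.
      by move=> x; rewrite !inE !mem_enum !inE.
    have : e |: Z = Z.
      apply: mZ; last exact: subsetUr.
      by rewrite subUset sub1set eE ZE -(perm_free (perm_map _ p)) /= free_cons he.
    by move/setP/(_ e); rewrite setU11 eZ.
  case/(span_coords sZ)=> [e0|[z [zE zc /coords_inj <- //]]].
    by have := coords_neq0 eE; rewrite e0 eqxx.
  by move: zc; rewrite set_enum.
rewrite /ind eqn_leq rk_leq_card //=.
apply: leq_trans (rk_sub_cl rkP EZ); rewrite -(basis_card rkP BE B_ind EB).
have := fZ; rewrite /free size_map -cardE => /eqP <-.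
by apply: leq_trans (dimvS (subvf _)) _; rewrite dimvf /dim /= mul1n.
Qed.

End Coordinates.

Lemma PG_coordinates E : simple_on rk E -> thirds rk E -> #|E| = 2 ^ rk E - 1 ->
  exists c : T -> 'rV['F_2]_(rk E), [/\ (forall x, x \in E -> c x != 0%R),
    {in E &, injective c} &
    forall X, X \subset E -> free [seq c x | x <- enum X] = ind rk X].
Proof.
move=> sE tE cE; have [B [BE iB EB]] := exists_basis rkP E.
have := coords_neq0 sE iB EB; have := coords_inj sE tE BE iB EB cE.
have := ind_free_coords sE tE BE iB EB cE; have := free_coords_ind sE tE BE iB EB cE.
move: (coords E B); rewrite (basis_card rkP BE iB EB) => c h1 h2 h3 h4.
by exists c; split=> // X XE; apply/idP/idP; [apply: h1|apply: h2].
Qed.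

End ProjectiveGeometry.

(** * Partitions into colour classes whose lines have third points *)

Lemma rk_bigcup (T I : finType) (rk : {set T} -> nat) (F : I -> {set T}) :
  rankfn rk -> rk (\bigcup_i F i) <= \sum_i rk (F i).
Proof.
move=> rkP; elim/big_rec2: _ => [|i n X _ h]; first by rewrite rk0.
by apply: leq_trans (rkU rkP _ _) _; rewrite leq_add2l.
Qed.

Lemma card_PG_type k : #|{: PG_type k}| = 2 ^ k - 1.
Proof.
rewrite card_sig; have := cardC1 (0%R : 'rV['F_2]_k); rewrite card_mx mul1n card_ord subn1.
by move=> <-; apply: eq_card => v; rewrite !inE.
Qed.

Section ColourClasses.
Variables (T : finType) (rk : {set T} -> nat) (t : nat) (c : T -> 'I_t).
Hypotheses (rkP : rankfn rk) (T_simple : simple_on rk setT).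
Let E (i : 'I_t) : {set T} := [set x | c x == i].
Hypothesis E_thirds : forall i, thirds rk (E i).
Hypothesis T_card : #|T| = minsize (rk setT) t.

Let bigcupE : \bigcup_i E i = setT.
Proof.
by apply/setP=> x; rewrite inE; apply/bigcupP; exists (c x); rewrite ?inE.
Qed.

Let simpleE i : simple_on rk (E i).
Proof. by apply: simple_onS T_simple; apply: subsetT. Qed.

(** With r_i the rank of class i and R the sum of the r_i, the chain |T| = sum |E_i| >= sum (2^r_i -
    1) >= f(R,t) >= f(r,t) + (R - r) has equal ends up to R - r, so every inequality is tight and R
    = r. *)
Lemma colour_classes_extremal : [/\ \sum_i rk (E i) = rk setT,
  (forall i j, rk (E i) <= (rk (E j)).+1) & forall i, #|E i| = 2 ^ rk (E i) - 1].
Proof.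
have lb i : 2 ^ rk (E i) - 1 <= #|E i| by apply: thirds_card_ge.
have [t0|t0] := posnP t.
  have T0 (x : T) : False by case: (c x) => i; rewrite t0.
  have I0 (i : 'I_t) : False by case: i => i; rewrite t0.
  split=> [|i|i]; try by case: (I0 i).
  have -> : [set: T] = set0 by apply/setP=> x; case: (T0 x).
  by rewrite rk0 // big1 // => i; case: (I0 i).
have J0 : 0 < #|'I_t| by rewrite card_ord.
have [h1 h2] := minsize_convex (fun i => rk (E i)) J0; rewrite card_ord in h1 h2.
have rR : rk setT <= \sum_i rk (E i) by rewrite -bigcupE rk_bigcup.
have cT : \sum_i #|E i| = #|T|.
  rewrite -sum1_card (partition_big c predT) //=; apply: eq_bigr => i _.
  by rewrite -sum1_card; apply: eq_bigl => x; rewrite inE.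
have l1 : \sum_i (2 ^ rk (E i) - 1) <= \sum_i #|E i| by apply: leq_sum.
have l2 := minsizeD_ge (rk setT) (\sum_i rk (E i) - rk setT) t; rewrite subnKC // in l2.
split; first by lia.
  by apply: h2; lia.
have ub : \sum_i #|E i| <= \sum_i (2 ^ rk (E i) - 1) by lia.
move=> i; have [_ /esym] := leqif_sum (fun i (_ : predT i) => leqif_eq (lb i)).
by rewrite eqn_leq l1 ub => /forall_inP/(_ i isT)/eqP.
Qed.

(** Extend each [X :&: E i] to a basis of [E i]. The union of these bases spans, and it has at most
    as many elements as the sum of the class ranks, which is the full rank; so it is independent. *)
Lemma colour_classes_ind X : ind rk X = [forall i, ind rk (X :&: E i)].
Proof.
have [sr _ _] := colour_classes_extremal.
apply/idP/forallP => [iX i|iX]; first by apply: indS iX => //; apply: subsetIl.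
have ex i : exists B : {set T}, [/\ X :&: E i \subset B, B \subset E i, ind rk B & E i \subset cl rk B].
  by apply: extend_basis; rewrite ?subsetIr.
have [B BP] := fin_all_exists ex.
have XB : X \subset \bigcup_i B i.
  apply/subsetP=> x xX; apply/bigcupP; exists (c x) => //.
  by have [/subsetP h _ _ _] := BP (c x); apply: h; rewrite !inE xX eqxx.
apply: (indS rkP XB); rewrite /ind eqn_leq rk_leq_card //=.
(* Cardinality is itself a rank function, so [rk_bigcup] also bounds the size of the union. *)
have cardP : rankfn (fun Y : {set T} => #|Y|).
  by split=> // [Y Z|Y Z]; [apply: subset_leq_card|rewrite cardsUI].
apply: leq_trans (rk_bigcup B cardP) _.
rewrite (@leq_trans (rk setT)) // -?sr.
  by apply: leq_sum => i _; have [_ BE /eqP <- _] := BP i; apply: rkS.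
rewrite sr.
apply: rk_sub_cl => //; rewrite -bigcupE; apply/bigcupsP=> i _.
have [_ _ _ h] := BP i; apply: subset_trans h _; apply: clS => //.
exact: bigcup_sup.
Qed.

Lemma colour_classes_iso (I : {set T} -> bool) : (forall X, I X = ind rk X) ->
  iso_Mrt I (rk setT) t.
Proof.
move=> IE; have [sr bal cE] := colour_classes_extremal.
have [phi phiP] := fin_all_exists (fun i => PG_coordinates rkP (simpleE i) (@E_thirds i) (cE i)).
have cc x : x \in E (c x) by rewrite inE.
have nz x : phi (c x) x != 0%R by have [h _ _] := phiP (c x); apply: h.
exists (fun i => rk (E i)); split=> //.
pose PG i := PG_type (rk (E i)).
pose f x : {i & PG i} := Tagged PG (exist (fun v => v != 0%R) (phi (c x) x) (nz x)).
(* Re-expresses [f x] at any index equal to its colour, avoiding casts between the types of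
   coordinate vectors. *)
have fE i x (n : phi i x != 0%R) : c x = i -> f x = Tagged PG (exist (fun v => v != 0%R) (phi i x) n).
  by move=> ci; subst i; congr (Tagged _ _); apply: val_inj.
have fi : injective f.
  move=> x y e; have cxy : c y = c x by have := congr1 tag e.
  have [_ inj _] := phiP (c x); apply: inj; rewrite ?inE ?cxy //.
  have n : phi (c x) y != 0%R by have := nz y; rewrite cxy.
  move: e; rewrite (fE _ _ n cxy) => /eqP; rewrite eq_Tagged => /eqP.
  by move/(congr1 val).
exists f; split.
  apply: inj_card_bij => //.
  rewrite card_tagged sumnE big_map big_enum /= T_card.
  rewrite (eq_bigr (fun i => #|E i|)) => [|i _]; last by rewrite card_PG_type cE.
  rewrite -T_card -[X in _ <= X]sum1_card (partition_big c predT) //=; apply: leq_sum => i _.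
  by rewrite -sum1_card leq_eqVlt; apply/orP; left; apply/eqP/eq_bigl => x; rewrite inE.
move=> X; rewrite IE colour_classes_ind; apply: eq_forallb => i.
have [_ inj <-] := phiP i; last exact: subsetIr.
(* The two lists hold the same vectors, possibly in different orders, and freeness does not depend
   on the order. *)
apply: perm_free; apply: uniq_perm.
- by rewrite map_inj_uniq ?enum_uniq //; apply: val_inj.
- rewrite map_inj_in_uniq ?enum_uniq // => x y; rewrite !mem_enum => /setIP[_ xE] /setIP[_ yE].
  exact: inj.
move=> w; apply/mapP/mapP=> -[].
  move=> v; rewrite mem_enum inE => /imsetP[x xX e] ->.
  have ci : c x = i by have := congr1 tag e.
  have n : phi i x != 0%R by rewrite -ci.
  exists x; first by rewrite mem_enum !inE xX ci eqxx.
  move: e; rewrite (fE _ _ n ci) => /eqP; rewrite eq_Tagged => /eqP.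
  by move/(congr1 val).
move=> x; rewrite mem_enum !inE => /andP[xX /eqP ci] ->.
have n : phi i x != 0%R by rewrite -ci.
exists (exist (fun v => v != 0%R) (phi i x) n) => //.
by rewrite mem_enum inE -(fE _ _ n ci) imset_f.
Qed.

End ColourClasses.

(** * Independence axioms and rank functions *)

Section MatroidRank.
Variables (T : finType) (I : {set T} -> bool).
Hypothesis matI : is_matroid I.
Implicit Types X Y B : {set T}.

Lemma indep_leq_mrank X Y : X \subset Y -> I X -> #|X| <= mrank I Y.
Proof. by move=> XY iX; apply: leq_bigmax_cond; rewrite XY. Qed.

Lemma mrank_basis X Y : X \subset Y -> I X ->
  exists B : {set T}, [/\ X \subset B, B \subset Y, I B & #|B| = mrank I Y].
Proof.
case: matI => I0 _ Iaug sXY iX.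
case: (@maxset_exists _ (fun Z : {set T} => (Z \subset Y) && I Z) X) => [|B].
  by rewrite sXY.
case/maxsetP=> /andP[BY iB] mB XB; exists B; split=> //.
apply/eqP; rewrite eqn_leq indep_leq_mrank //=; apply/bigmax_leqP => Z /andP[ZY iZ].
rewrite leqNgt; apply/negP=> /(Iaug _ _ iB iZ)[e /setDP[eZ eB] ieB].
have : e |: B = B by apply: mB; rewrite ?subsetUr // subUset sub1set (subsetP ZY) ?BY.
by move/setP/(_ e); rewrite setU11 (negbTE eB).
Qed.

Lemma mrank_rankfn : rankfn (mrank I).
Proof.
case: matI => I0 Isub _; split=> [X|X Y XY|X Y].
- by apply/bigmax_leqP => Z /andP[ZX _]; apply: subset_leq_card.
- have [B [_ BX iB <-]] := mrank_basis (sub0set X) I0.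
  by apply: indep_leq_mrank iB; apply: subset_trans XY.
(* Submodularity from nested bases: [A] of X ∩ Y extends to [B] of X and then to [C] of X ∪ Y. The
   elements of C - B lie in Y, so A ∪ (C - B) is an independent subset of Y. *)
have [A [_ AI iA <-]] := mrank_basis (sub0set (X :&: Y)) I0.
have [B [AB BX iB eB]] := mrank_basis (subset_trans AI (subsetIl X Y)) iA.
have [C [BC CU iC <-]] := mrank_basis (subset_trans BX (subsetUl X Y)) iB.
have CB c : c \in C :\: B -> c \in Y.
  case/setDP=> cC cB; have /setUP[cX|//] := subsetP CU c cC.
  have icB : I (c |: B) by apply: Isub iC _; rewrite subUset sub1set cC.
  have : #|c |: B| <= mrank I X by apply: indep_leq_mrank icB; rewrite subUset sub1set cX.
  by rewrite cardsU1 cB eB ltnn.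
have : #|A :|: (C :\: B)| <= mrank I Y.
  apply: indep_leq_mrank.
    rewrite subUset (subset_trans AI (subsetIr X Y)); apply/subsetP; exact: CB.
  by apply: Isub iC _; rewrite subUset (subset_trans AB BC) subsetDl.
have -> : #|A :|: (C :\: B)| = #|A| + #|C :\: B|.
  rewrite cardsU (_ : A :&: (C :\: B) = set0) ?cards0 ?subn0 //.
  by apply/setP=> z; rewrite !inE; case zA: (z \in A); rewrite // (subsetP AB).
have := cardsD C B; rewrite (setIidPr BC); have := subset_leq_card BC; lia.
Qed.

Lemma indepE X : I X = ind (mrank I) X.
Proof.
apply/idP/eqP => [iX|e].
  apply/eqP; rewrite eqn_leq indep_leq_mrank // andbT.
  by case: mrank_rankfn.
case: matI => I0 _ _; have [B [_ BX iB eB]] := mrank_basis (sub0set X) I0.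
suff <- : B = X by [].
by apply/eqP; rewrite eqEcard BX eB e /=.
Qed.

Lemma simple_matroid_on : simple_matroid I -> simple_on (mrank I) setT.
Proof.
case=> s1 s2; split=> [x _|x y _ _ yx]; first by rewrite -indepE.
apply/eqP/negPn/negP=> xy; have := s2 _ _ xy; rewrite indepE.
move/(ind_notin_cl mrank_rankfn); rewrite yx inE xy => /(_ isT) //.
Qed.

Lemma claw_onT X : claw_on (mrank I) setT X = claw I X.
Proof.
rewrite /claw_on /claw subsetT setIT -indepE /= andbC; congr (_ && _).
apply/subsetP/forallP => [h e|h e eX].
  apply/implyP => eX; have := contra (h e) eX; rewrite in_cl => ne.
  have := rkS mrank_rankfn (subsetUr [set e] X); lia.
apply/negPn/negP => /(implyP (h e)); rewrite in_cl in eX; lia.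
Qed.

(** Subsets of claws are claws, so a larger claw would contain one of size exactly t + 1. *)
Lemma no_claw_leq t : ~ has_k_claw I t.+1 ->
  forall X, claw_on (mrank I) setT X -> #|X| <= t.
Proof.
move=> nc X cX; rewrite leqNgt; apply/negP=> tX; apply: nc.
exists [set x in take t.+1 (enum X)]; split.
  rewrite -claw_onT; apply: (claw_sub mrank_rankfn _ cX); apply/subsetP=> x.
  by rewrite inE => /mem_take; rewrite mem_enum.
rewrite cardsE (card_uniqP _) ?take_uniq ?enum_uniq // size_take -cardE.
by case: ltnP => //; lia.
Qed.

End MatroidRank.

Lemma ind_circuit (T : finType) (rk : {set T} -> nat) (A : {set T}) y : rankfn rk ->
  ind rk A -> y \notin A -> y \in cl rk A ->
  (forall b, b \in A -> y \notin cl rk (A :\ b)) -> circuit (ind rk) (y |: A).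
Proof.
move=> rkP iA yA yc h; apply/andP; split.
  by apply: contraL yc => iyA; apply: ind_notin_cl rkP _ _ iyA yA.
apply/forallP=> Y; apply/implyP => /properP[sY [b]].
rewrite !inE => /orP[/eqP->|bA] bY.
  by apply: (indS rkP _ iA); rewrite -(setU1K yA) subsetD1 sY.
apply: (indS rkP (Y := y |: A :\ b)).
  apply/subsetP=> z zY; have := subsetP sY z zY; rewrite !inE; case: eqP => //= _ ->.
  by rewrite andbT; apply: contraNneq bY => <-.
by apply: indU1 => //; [apply: indS iA => //; apply: subD1set|apply: h].
Qed.

Lemma circuit_cl (T : finType) (rk : {set T} -> nat) (C : {set T}) d : rankfn rk ->
  circuit (ind rk) C -> d \in C -> d \in cl rk (C :\ d).
Proof.
move=> rkP /andP[nC /forallP h] dC; apply: contraR nC => nd.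
rewrite -(setD1K dC) indU1 //; apply: (implyP (h _)); exact: properD1.
Qed.

(** * The case of equality *)

Section Equality.
Variables (T : finType) (rk : {set T} -> nat) (t : nat).
Hypotheses (t0 : 0 < t) (rkP : rankfn rk) (T_simple : simple_on rk setT).
Hypothesis claw_leq : forall X, claw_on rk setT X -> #|X| <= t.
Hypothesis T_card : #|T| = minsize (rk setT) t.
Variable S : {set T}.
Hypothesis tS : tclaw rk setT t S.
Implicit Types (x y z a b e : T).

Let E_card : #|[set: T]| = minsize (rk setT) t.
Proof. by rewrite cardsT. Qed.
Let cS : claw_on rk setT S. Proof. exact: tclaw_claw tS. Qed.
Let St : #|S| = t. Proof. by case/andP: tS => _ /eqP. Qed.
Let iS : ind rk S. Proof. by case/and3P: cS. Qed.
Local Notation footS := (foot rk setT S).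
Local Notation partnerS := (partner rk setT S).
Local Notation E' := (simplification rk setT S).
Let partnerSP := partnerP t0 rkP T_simple claw_leq E_card tS.
Let partnerS_in_cl := partner_in_cl t0 rkP T_simple claw_leq E_card tS.
Let footS_partner := foot_partner t0 rkP T_simple claw_leq E_card tS.

Let inES x : (x \in setT :\: S) = (x \notin S).
Proof. by rewrite inE in_setT andbT. Qed.

Lemma foot_crep x : x \notin S -> footS (crep rk setT S x) = footS x.
Proof.
rewrite -inES => xS; have [h1 h2] := crepP rk xS.
have [_ _ _ /(_ _ h2 h1)/orP[/eqP->//|/eqP->]] := partnerSP xS.
exact: footS_partner.
Qed.

(** * Singleton feet as a colouring *)

Section Colouring.
Hypothesis foot1 : forall x, x \notin S -> #|footS x| = 1.
Hypothesis foot_third : forall x y e, x \notin S -> y \notin S -> y \notin cl rk (x |: S) ->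
  footS x = [set e] -> footS y = [set e] ->
  exists z, [/\ z \notin S, footS z = [set e], z != x, z != y & z \in cl rk [set x; y]].

Let d x : T := if x \in S then x else odflt x [pick e in footS x].

Let dS x : x \in S -> d x = x. Proof. by rewrite /d => ->. Qed.

Let d_foot x : x \notin S -> footS x = [set d x].
Proof.
move=> xS; have /eqP/cards1P[e fe] := foot1 xS; rewrite /d (negbTE xS) fe.
by case: pickP => [z /set1P->|/(_ e)] //; rewrite inE eqxx.
Qed.

Let d_in x : d x \in S.
Proof.
case xS: (x \in S); first by rewrite dS.
by apply: (subsetP (foot_sub rk setT S x)); rewrite d_foot ?xS // inE.
Qed.

Let partner_line x : x \notin S -> [/\ d (partnerS x) = d x, partnerS x \notin S,
  partnerS x != x & partnerS x \in cl rk [set x; d x]].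
Proof.
move=> xS; have xES : x \in setT :\: S by rewrite inES.
have [h1 h2 _ _] := partnerSP xES; rewrite inES in h2.
split=> //; last by have := partnerS_in_cl xES; rewrite d_foot.
by apply/set1_inj; rewrite -!d_foot // footS_partner.
Qed.

(** If one of the points is the colour e itself, the partner of the other is a third point; if the
    two are partners, e is; otherwise they are not parallel in M/S and [foot_third] applies. *)
Let d_thirds x y : d x = d y -> x != y ->
  exists z, [/\ d z = d x, z != x, z != y & z \in cl rk [set x; y]].
Proof.
have case1 u v : u \in S -> d u = d v -> u != v ->
    exists z, [/\ d z = d u, z != u, z != v & z \in cl rk [set u; v]].
  move=> uS; rewrite dS // => e uv.
  have vS : v \notin S by apply: contraNN uv => vS; rewrite e dS.
  have [h1 h2 h3 h4] := partner_line vS; exists (partnerS v); rewrite h1 h3 setUC.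
  by rewrite e h4; split=> //; apply: contraNneq h2 => ->.
move=> e xy; case xS: (x \in S); first exact: case1.
case yS: (y \in S).
  rewrite eq_sym in xy; have [z [z1 z2 z3 z4]] := case1 y x yS (esym e) xy.
  by exists z; rewrite z1 setUC.
move: xS yS => /negbT xS /negbT yS.
have xES : x \in setT :\: S by rewrite inES.
have yES : y \in setT :\: S by rewrite inES.
case yx: (y \in cl rk (x |: S)).
  have [_ _ _ /(_ y yES yx)] := partnerSP xES; rewrite eq_sym (negbTE xy) /= => /eqP ey.
  have [_ _ _ h4] := partner_line xS; rewrite -ey in h4.
  exists (d x); rewrite dS //; split=> //.
  - by apply: contraNneq xS => <-.
  - by apply: contraNneq yS => <-.
  by apply: (line_exch rkP T_simple) h4 _; rewrite ?inE // eq_sym.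
have [z [zS fz zx zy zc]] := foot_third xS yS (negbT yx) (d_foot xS) (etrans (d_foot yS) (congr1 _ (esym e))).
by exists z; split=> //; apply/set1_inj; rewrite -d_foot.
Qed.

Lemma foot_colouring_iso I : (forall X, I X = ind rk X) -> iso_Mrt I (rk setT) t.
Proof.
move=> IE; have /card_gt0P[e0 e0S] : 0 < #|S| by rewrite St.
pose c x : 'I_t := cast_ord St (enum_rank_in e0S (d x)).
have cE x y : c x = c y -> d x = d y.
  by move/cast_ord_inj => e; rewrite -(enum_rankK_in e0S (d_in x)) e enum_rankK_in.
apply: (colour_classes_iso rkP T_simple _ T_card IE (c := c)) => i x y.
rewrite !inE => /eqP cx /eqP cy xy.
have [z [z1 z2 z3 z4]] := d_thirds (cE _ _ (etrans cx (esym cy))) xy.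
by exists z; rewrite inE -cx /c z1 eqxx.
Qed.

End Colouring.

Lemma big_rank_iso I : t <= rk setT - t ->
  (forall X, I X = ind rk X) -> iso_Mrt I (rk setT) t.
Proof.
move=> tr; have card1 S' x : tclaw rk setT t S' -> x \notin S' ->
    #|foot rk setT S' x| = 1.
  move=> tS' xS'; apply: (foot_card1 t0 rkP T_simple claw_leq E_card tS' tr).
  by rewrite inE in_setT andbT.
apply: foot_colouring_iso => [x|x y e xS yS yx fx fy]; first exact: card1.
have xES : x \in setT :\: S by rewrite inES.
have yES : y \in setT :\: S by rewrite inES.
have ex : e \in footS x by rewrite fx inE.
have ey : e \in footS y by rewrite fy inE.
have tS1 := foot_swap t0 rkP T_simple claw_leq E_card tS xES ex.
have [] := foot_meet t0 rkP T_simple claw_leq E_card tS xES yES yx ex ey.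
set S1 := x |: S :\ e in tS1 *; set p := partner _ _ _ _ => pES _ px py ep.
have pS : p \notin S by rewrite -inES.
have yS1 : y \notin S1.
  rewrite !inE negb_or (negbTE yS) andbF andbT.
  by apply: contraNneq yx => ->; rewrite (subsetP (sub_cl rk _)) // setU11.
exists p; split=> //.
- by have /eqP/cards1P[e' fp] := card1 S p tS pS; move: ep; rewrite fp => /set1P ->.
- by apply: contraNneq px => ->; rewrite (subsetP (sub_cl rk _)) // setU11.
- by apply: contraNneq py => ->; rewrite (subsetP (sub_cl rk _)) // setU11.
have yES1 : y \in setT :\: S1 by rewrite inE yS1 inE.
(* The foot of y relative to S1 is a single element f, so p is on the line through y and f. If f
   were in [S], then p would be in cl(y + S); hence f = x. *)
have /eqP/cards1P[f ff] := card1 S1 y tS1 yS1.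
have := partner_in_cl t0 rkP T_simple claw_leq E_card tS1 yES1; rewrite -/p ff => pc.
have : f \in S1 by apply: (subsetP (foot_sub rk setT S1 y)); rewrite ff inE.
rewrite in_setU1 => /orP[/eqP fx'|fS]; first by rewrite setUC -fx'.
case/negP: py; apply: (subsetP (clS rkP _)) pc; apply: setUS.
by rewrite sub1set; move: fS; rewrite inE => /andP[].
Qed.

(** * Equality in rank at most 2t: disjoint circuits *)

Section SmallRank.
Hypothesis small : rk setT <= 2 * t.

Let cE' := simplification_is_claw t0 rkP T_simple claw_leq E_card tS small.

Let in_E'S a : a \in E' -> a \notin S.
Proof. by move/(subsetP (simplification_sub rk setT S)); rewrite inES. Qed.

Lemma small_rank_foot_disjoint a b e : a \in E' -> b \in E' -> e \in footS a -> e \in footS b ->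
  a = b.
Proof.
move=> aE bE ea eb; apply/eqP/negPn/negP=> ab.
by have := foot_disjoint t0 rkP T_simple claw_leq E_card tS cE' aE bE ab ea; rewrite eb.
Qed.

(** The third-point condition is vacuous: feet of different classes are disjoint, so two elements
    with the same foot are parallel in M/S. *)
Lemma small_rank_iso I : (forall x, x \notin S -> #|footS x| = 1) ->
  (forall X, I X = ind rk X) -> iso_Mrt I (rk setT) t.
Proof.
move=> f1; apply: foot_colouring_iso => // x y e xS yS yx fx fy.
have xES : x \in setT :\: S by rewrite inES.
have yES : y \in setT :\: S by rewrite inES.
case/negP: yx; rewrite -(crep_eq rkP cS xES yES); apply/eqP/(@small_rank_foot_disjoint _ _ e).
- exact: crep_simplification.
- exact: crep_simplification.
- by rewrite foot_crep // fy inE.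
- by rewrite foot_crep // fx inE.
Qed.

Definition foot_circuit a : {set T} := partnerS a |: (a |: footS a).

Let foot_subS a : footS a \subset S. Proof. exact: foot_sub. Qed.

(** An element determines its circuit: inside [S] through the disjoint feet, outside [S] through its
    parallel class. *)
Lemma foot_circuit_owner a z : a \in E' -> z \in foot_circuit a ->
  if z \in S then z \in footS a else crep rk setT S z == a.
Proof.
move=> aE'; have aS := in_E'S aE'; have aES : a \in setT :\: S by rewrite inES.
have [h1 h2 h3 _] := partnerSP aES.
case: ifPn => zS; rewrite !in_setU1 => /or3P[/eqP e|/eqP e|h] //.
- by move: h2; rewrite inES -e zS.
- by rewrite -e zS in aS.
- by rewrite e -[eqbRHS](crep_id rkP cS aE') crep_eq.
- by rewrite e (crep_id rkP cS aE').
- by rewrite (subsetP (foot_subS a)) in zS.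
Qed.

Lemma foot_circuit_disjoint a b z : a \in E' -> b \in E' ->
  z \in foot_circuit a -> z \in foot_circuit b -> a = b.
Proof.
move=> aE bE /(foot_circuit_owner aE) za /(foot_circuit_owner bE).
by move: za; case: ifP => _ h1 h2; [apply: small_rank_foot_disjoint h1 h2|rewrite -(eqP h1) (eqP h2)].
Qed.

Lemma foot_circuitP a : a \in E' -> circuit (ind rk) (foot_circuit a).
Proof.
move=> aE'; have aS := in_E'S aE'; have aES : a \in setT :\: S by rewrite inES.
have [h1 h2 h3 _] := partnerSP aES.
have ia : ind rk (a |: S) by apply: indU1 => //; apply: (claw_notin_cl cS).
have pS : partnerS a \notin S by rewrite -inES.
apply: ind_circuit => //.
- by apply: indS ia => //; apply: setUS.
- rewrite in_setU1 negb_or h1; apply: contraNN pS; exact: (subsetP (foot_subS a)).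
- exact: partnerS_in_cl.
move=> b /setU1P[->|bf].
  apply: contraNN (claw_notin_cl cS h2); apply/subsetP/clS => //.
  by apply/subsetP=> z; rewrite !in_setD1 in_setU1 => /andP[/negbTE-> /(subsetP (foot_subS a))].
have : partnerS a \notin cl rk (a |: S :\ b) by case/setIdP: bf.
apply: contraNN; apply/subsetP/clS => //; apply/subsetP=> z.
rewrite !in_setD1 !in_setU1 in_setD1 => /andP[-> /orP[->//|/(subsetP (foot_subS a))->]].
by rewrite orbT.
Qed.

Lemma card_foot_circuit a : a \in E' -> #|foot_circuit a| = #|footS a|.+2.
Proof.
move=> aE'; have aS := in_E'S aE'; have aES : a \in setT :\: S by rewrite inES.
have [h1 h2 _ _] := partnerSP aES; rewrite inES in h2.
rewrite /foot_circuit !cardsU1 !in_setU1 negb_or h1.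
by rewrite (contraNN (subsetP (foot_subS a) _) h2) (contraNN (subsetP (foot_subS a) _) aS).
Qed.

(** Remove from each circuit one element outside [X]. What remains contains [X], spans the matroid
    because each removed element is in the closure of the rest of its circuit, and has exactly r
    elements. *)
Lemma foot_circuits_ind X : (forall a, a \in E' -> ind rk (X :&: foot_circuit a)) -> ind rk X.
Proof.
move=> iX.
have ex a : exists z, a \in E' -> z \in foot_circuit a /\ z \notin X.
  case aE': (a \in E'); last by exists a.
  have /subsetPn[z zC zX] : ~~ (foot_circuit a \subset X).
    have /andP[nC _] := foot_circuitP aE'.
    by apply: contraNN nC => /setIidPr <-; apply: iX.
  by exists z.
have [d dP] := fin_all_exists ex.
have dinj : {in E' &, injective d}.
  move=> a b aE bE e; have [h1 _] := dP a aE; have [h2 _] := dP b bE.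
  by apply: (foot_circuit_disjoint aE bE h1); rewrite e.
have XZ : X \subset ~: (d @: E').
  apply/subsetP=> x xX; rewrite inE; apply/negP=> /imsetP[a aE ex'].
  by have [_] := dP a aE; rewrite -ex' xX.
apply: (indS rkP XZ); rewrite /ind eqn_leq rk_leq_card //=.
have tr : t <= rk setT by rewrite -St; exact: (claw_rank rkP cS).
(* Here |T| = t + 2(r - t), and r - t elements are removed. *)
have -> : #|~: (d @: E')| = rk setT.
  have := cardsC (d @: E'); rewrite card_in_imset // T_card.
  rewrite (tclaw_simplification_card t0 rkP T_simple claw_leq E_card tS).
  rewrite (@minsize_small (_ - t)); last lia.
  have {2}-> : rk setT = rk setT - t + t by lia.
  rewrite minsizeDt // minsize_small; lia.
apply: rk_sub_cl => //; apply/subsetP=> x _.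
case xd: (x \in d @: E'); last by rewrite (subsetP (sub_cl rk _)) // inE xd.
have /imsetP[a aE ->] := xd; have [h1 h2] := dP a aE.
apply: (subsetP (clS rkP _)) (circuit_cl rkP (foot_circuitP aE) h1).
apply/subsetP=> z; rewrite in_setD1 in_setC => /andP[zd zC]; apply/negP=> /imsetP[b bE ez].
have [h3 _] := dP b bE; rewrite -ez in h3.
by rewrite (foot_circuit_disjoint aE bE zC h3) ez eqxx in zd.
Qed.

Lemma small_rank_circuits I x0 : x0 \notin S -> #|footS x0| != 1 ->
  (forall X, I X = ind rk X) -> coloops_circuits_dsum I (rk setT - t).
Proof.
move=> x0S fx0 IE.
have eC C : circuit I C = circuit (ind rk) C.
  by rewrite /circuit IE; congr (_ && _); apply: eq_forallb => Y; rewrite IE.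
have i1 e : I [set e] by rewrite IE; case: T_simple => + _; apply; rewrite inE.
have cardE' : #|E'| = rk setT - t.
  rewrite (tclaw_simplification_card t0 rkP T_simple claw_leq E_card tS) minsize_small //; lia.
rewrite -cardE'; exists (fun j => foot_circuit (enum_val j)); split=> //.
- move=> i j ij; rewrite -setI_eq0; apply/eqP/setP=> z; rewrite in_setI in_set0.
  apply/negbTE/negP => /andP[zi zj]; case/eqP: ij.
  exact/enum_val_inj/(foot_circuit_disjoint (enum_valP i) (enum_valP j) zi zj).
- by move=> j; rewrite eC; apply/foot_circuitP/enum_valP.
- move=> X; apply/idP/andP => [iX|[_ /forallP h]].
    split; first by apply/forall_inP.
    by apply/forallP=> j; move: iX; rewrite !IE; apply: indS => //; apply: subsetIl.
  rewrite IE; apply: foot_circuits_ind => a aE.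
  by have := h (enum_rank_in aE a); rewrite enum_rankK_in // IE.
(* The circuit of x0 has two elements more than its foot, hence not three. *)
have x0E : crep rk setT S x0 \in E' by apply: crep_simplification; rewrite inES.
exists (enum_rank_in x0E (crep rk setT S x0)).
by rewrite /triangle enum_rankK_in // card_foot_circuit // foot_crep // !eqSS negb_and fx0 orbT.
Qed.

End SmallRank.

End Equality.

(** Here |T| = r <= t, so each element can have a colour of its own, and no colour class contains a
    line. *)
Lemma free_iso (T : finType) (rk : {set T} -> nat) t I : rankfn rk -> simple_on rk setT ->
  #|T| = minsize (rk setT) t -> rk setT <= t -> (forall X, I X = ind rk X) ->
  iso_Mrt I (rk setT) t.
Proof.
move=> rkP sT cT rt IE; have Tt : #|T| <= t by rewrite cT minsize_small.
pose c x : 'I_t := widen_ord Tt (enum_rank x).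
apply: (colour_classes_iso rkP sT _ cT IE (c := c)) => i x y.
rewrite !inE => /eqP <- /eqP /(congr1 val) /= e; case/eqP.
by apply/enum_rank_inj/val_inj/esym.
Qed.

Theorem theorem3p3 (t r : nat) (T : finType) (I : {set T} -> bool) :
  1 <= t ->
  is_matroid I -> simple_matroid I -> matroid_rank I = r ->
  ~ has_k_claw I t.+1 ->
  f_rt r t <= #|T| /\
  (#|T| = f_rt r t ->
     iso_Mrt I r t \/
     ((t < r < 2 * t) /\ coloops_circuits_dsum I (r - t))).
Proof.
move=> t0 matI simI <- noclaw; rewrite f_rtE // /matroid_rank.
have rkP := mrank_rankfn matI; have IE := indepE matI.
have sT := simple_matroid_on matI simI; have cl := no_claw_leq matI noclaw.
split; first by have := size_bound t0 rkP sT cl; rewrite cardsT.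
move=> cT; have cT' : #|[set: T]| = minsize (mrank I setT) t by rewrite cardsT.
have [rt|tr] := leqP (mrank I setT) t; first by left; apply: free_iso.
have [S tS _] := tclaw_extend t0 rkP sT cl cT' (ltnW tr) (claw0 rkP sT).
have [r2t|tr2] := leqP (2 * t) (mrank I setT).
  by left; apply: (big_rank_iso t0 rkP sT cl cT tS) => //; lia.
(* For t < r < 2t, singleton feet give M_{r,t}, while a foot of another size gives a circuit that is
   not a triangle. *)
have [/forall_inP f1|/forall_inPn[x xS fx]] :=
  boolP [forall x in ~: S, #|foot (mrank I) setT S x| == 1].
  left; apply: (small_rank_iso t0 rkP sT cl cT tS (ltnW tr2)) => // x xS.
  by apply/eqP/f1; rewrite inE.
right; split=> //; apply: (small_rank_circuits t0 rkP sT cl cT tS (ltnW tr2) _ fx) => //.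
by rewrite inE in xS.
Qed.
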